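(* Let $T$ be a quaternionic torus. The group $Aut(T)$ of biregular automorphisms of $T$ is isomorphic to the group $2D_6$ if and only if there exist $I,J\in\mathbb S$ with $J\perp I$ such that the point $(e^{\frac{\pi I}{3}},J,Je^{\frac{\pi I}{3}})$ is (a representative of) the modulus of $T$.
   Context: $\mathbb H\cong\mathbb R^4$ is the skew field of quaternions with its Euclidean scalar product $\langle\cdot,\cdot\rangle$ and norm $|\cdot|$; $\mathbb S=\{q\in\mathbb H: q^2=-1\}$, $\mathbb S^3=\{q\in\mathbb H:|q|=1\}$, and $e^{\alpha I}=\cos\alpha+I\sin\alpha$ for $I\in\mathbb S$. A function $f:\Omega\to\mathbb H$ on a domain $\Omega\subseteq\mathbb H$ is (slice) regular if for every $I\in\mathbb S$ its restriction $f_I$ to $\Omega\cap(\mathbb R+I\mathbb R)$ has continuous derivatives and $\frac12\left(\frac{\partial}{\partial x}+I\frac{\partial}{\partial y}\right)f_I(x+Iy)=0$. A rank-4 lattice in $\mathbb H$ is the additive subgroup generated by four $\mathbb R$-linearly independent elements. A quaternionic torus is a quotient $T=\mathbb H/L$, $L$ a rank-4 lattice, with the atlas of local inverses of the projection $\pi:\mathbb H\to\mathbb H/L$ on small connected open sets. A map between two quaternionic tori is regular if its expressions in these charts are slice regular; a biregular diffeomorphism is a bijective regular map with regular inverse. Two tori are equivalent if there is a biregular diffeomorphism of one onto the other. For $T=\mathbb H/L$, $Aut(T)$ is the group (under composition) of maps $F(q)=qa$ with $a\in\mathbb S^3$ and $F(L)=L$. The Gram matrix of an (ordered) basis $\{v_1,v_2,v_3,v_4\}$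 of a rank-4 lattice is $(\langle v_i,v_j\rangle)_{i,j}$. A Gram matrix $R=(r_{i,j})$ is reduced (in the sense of Minkowski–Siegel) if and only if: B1) $r_{k,k+1}\ge 0$ for $k=1,2,3$; B2) for each $k=1,2,3,4$, $n R\,{}^tn\ge r_{k,k}$ for every $n=(n_1,n_2,n_3,n_4)\in\mathbb Z^4$ such that $\gcd(n_k,\dots,n_4)=1$. A special basis is a basis whose Gram matrix is reduced and whose first element is $1$. $\mathcal M=\{(v_2,v_3,v_4)\in\mathbb H^3:\{1,v_2,v_3,v_4\}\text{ is a special basis}\}$. A triple $(v_2,v_3,v_4)$ is (a representative of) the modulus of $T$ if $(v_2,v_3,v_4)\in\mathcal M$ and $T$ is equivalent to $\mathbb H/(\mathbb Z+\mathbb Zv_2+\mathbb Zv_3+\mathbb Zv_4)$. $2D_6$ is the group of order $12$ generated in $\mathbb S^3$ by $e^{\pi I/3}$ and $J$, where $I,J\in\mathbb S$ are orthogonal. *)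

(* Defs.v *)
From HB Require Import structures.
From mathcomp Require Import all_boot all_order all_algebra.
From mathcomp Require Import all_classical all_reals all_analysis.
From mathcomp Require Import ring.

Set Implicit Arguments.
Unset Strict Implicit.
Unset Printing Implicit Defensive.

Import Order.TTheory GRing.Theory Num.Theory.
Import numFieldNormedType.Exports.

Local Open Scope classical_set_scope.
Local Open Scope quotient_scope.
Local Open Scope ring_scope.

(* The row (a, b, c, d) stands for a + b i + c j + d k.  The norm `|_| inherited
   from row vectors is the sup norm, which is used only for the topology; the
   Euclidean norm is [qnorm] below. *)
Definition quat (R : realType) : Type := 'rV[R]_4.

Section quaternion_algebra.
Context {R : realType}.

HB.instance Definition _ := Vector.copy (quat R) 'rV[R]_4.
HB.instance Definition _ := NormedModule.copy (quat R) 'rV[R]_4.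

Definition Quat (a b c d : R) : quat R :=
  \row_i [:: a; b; c; d]`_i.

Definition qre (x : quat R) : R := (x : 'rV[R]_4) 0 (inord 0).
Definition qi (x : quat R) : R := (x : 'rV[R]_4) 0 (inord 1).
Definition qj (x : quat R) : R := (x : 'rV[R]_4) 0 (inord 2).
Definition qk (x : quat R) : R := (x : 'rV[R]_4) 0 (inord 3).

Definition qmul (x y : quat R) : quat R :=
  Quat (qre x * qre y - qi x * qi y - qj x * qj y - qk x * qk y)
       (qre x * qi y + qi x * qre y + qj x * qk y - qk x * qj y)
       (qre x * qj y - qi x * qk y + qj x * qre y + qk x * qi y)
       (qre x * qk y + qi x * qj y - qj x * qi y + qk x * qre y).

Definition qdot (x y : quat R) : R :=
  \sum_i (x : 'rV[R]_4) 0 i * (y : 'rV[R]_4) 0 i.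

Definition qnorm (x : quat R) : R := Num.sqrt (qdot x x).

Definition qconj (x : quat R) : quat R := Quat (qre x) (- qi x) (- qj x) (- qk x).

Definition qinv (x : quat R) : quat R := (qdot x x)^-1 *: qconj x.

Lemma quatP (x y : quat R) :
  qre x = qre y -> qi x = qi y -> qj x = qj y -> qk x = qk y -> x = y.
Proof.
move=> e0 e1 e2 e3; apply/rowP => i; rewrite -(inord_val i).
by case: i => -[|[|[|[|//]]]] i.
Qed.

Lemma qreE a b c d : qre (Quat a b c d) = a.
Proof. by rewrite /qre mxE inordK. Qed.
Lemma qiE a b c d : qi (Quat a b c d) = b.
Proof. by rewrite /qi mxE inordK. Qed.
Lemma qjE a b c d : qj (Quat a b c d) = c.
Proof. by rewrite /qj mxE inordK. Qed.
Lemma qkE a b c d : qk (Quat a b c d) = d.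
Proof. by rewrite /qk mxE inordK. Qed.

Lemma qreD x y : qre (x + y) = qre x + qre y. Proof. exact: mxE. Qed.
Lemma qiD x y : qi (x + y) = qi x + qi y. Proof. exact: mxE. Qed.
Lemma qjD x y : qj (x + y) = qj x + qj y. Proof. exact: mxE. Qed.
Lemma qkD x y : qk (x + y) = qk x + qk y. Proof. exact: mxE. Qed.

Lemma qreZ a x : qre (a *: x) = a * qre x. Proof. exact: mxE. Qed.
Lemma qiZ a x : qi (a *: x) = a * qi x. Proof. exact: mxE. Qed.
Lemma qjZ a x : qj (a *: x) = a * qj x. Proof. exact: mxE. Qed.
Lemma qkZ a x : qk (a *: x) = a * qk x. Proof. exact: mxE. Qed.

Definition qcoordE := (qreE, qiE, qjE, qkE, qreD, qiD, qjD, qkD,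
                       qreZ, qiZ, qjZ, qkZ).

Lemma qdotE x y :
  qdot x y = qre x * qre y + qi x * qi y + qj x * qj y + qk x * qk y.
Proof.
rewrite /qdot !big_ord_recr big_ord0 /= add0r /qre /qi /qj /qk.
by congr (_ + _ + _ + _); congr (_ * _); congr (_ 0 _); apply/val_inj;
  rewrite /= inordK.
Qed.

Fact qmulA : associative qmul.
Proof. by move=> x y z; apply: quatP; rewrite /qmul !qcoordE; ring. Qed.
Fact qmul1q : left_id (Quat 1 0 0 0) qmul.
Proof. by move=> x; apply: quatP; rewrite /qmul !qcoordE; ring. Qed.
Fact qmulq1 : right_id (Quat 1 0 0 0) qmul.
Proof. by move=> x; apply: quatP; rewrite /qmul !qcoordE; ring. Qed.
Fact qmulDl : left_distributive qmul +%R.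
Proof. by move=> x y z; apply: quatP; rewrite /qmul !qcoordE; ring. Qed.
Fact qmulDr : right_distributive qmul +%R.
Proof. by move=> x y z; apply: quatP; rewrite /qmul !qcoordE; ring. Qed.
Fact qone_neq0 : Quat 1 0 0 0 != 0.
Proof.
apply/eqP => /(congr1 qre); rewrite qreE /qre mxE => /eqP.
by rewrite oner_eq0.
Qed.

HB.instance Definition _ := GRing.Zmodule_isNzRing.Build (quat R)
  qmulA qmul1q qmulq1 qmulDl qmulDr qone_neq0.

Fact qscalerAl (a : R) (x y : quat R) : a *: (x * y) = (a *: x) * y.
Proof. by apply: quatP; rewrite /GRing.mul /= /qmul !qcoordE; ring. Qed.
HB.instance Definition _ := GRing.Lmodule_isLalgebra.Build R (quat R) qscalerAl.

Fact qscalerAr (a : R) (x y : quat R) : a *: (x * y) = x * (a *: y).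
Proof. by apply: quatP; rewrite /GRing.mul /= /qmul !qcoordE; ring. Qed.
HB.instance Definition _ := GRing.Lalgebra_isAlgebra.Build R (quat R) qscalerAr.

Lemma qdot_eq0 (x : quat R) : (qdot x x == 0) = (x == 0).
Proof.
apply/eqP/eqP => [x0|->].
  apply/rowP => i; rewrite mxE.
  have /allP/(_ i) : all (fun i : 'I_4 => true ==>
      ((x : 'rV[R]_4) 0 i * (x : 'rV[R]_4) 0 i == 0)) (index_enum 'I_4).
    rewrite -psumr_eq0; first by apply/eqP.
    by move=> j _; rewrite -expr2 sqr_ge0.
  by rewrite mem_index_enum -expr2 sqrf_eq0 => /(_ isT)/eqP.
by rewrite /qdot big1 // => i _; rewrite mxE mul0r.
Qed.

Fact qmulVq (x : quat R) : x != 0 -> qinv x * x = 1.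
Proof.
rewrite -qdot_eq0 => x0; rewrite /qinv -qscalerAl.
have -> : qconj x * x = qdot x x *: 1.
  apply: quatP; rewrite /qconj /GRing.mul /GRing.one /= /qmul !qcoordE ?qdotE;
  ring.
by rewrite scalerA mulVf // scale1r.
Qed.

Fact qmulqV (x : quat R) : x != 0 -> x * qinv x = 1.
Proof.
rewrite -qdot_eq0 => x0; rewrite /qinv -qscalerAr.
have -> : x * qconj x = qdot x x *: 1.
  apply: quatP; rewrite /qconj /GRing.mul /GRing.one /= /qmul !qcoordE ?qdotE;
  ring.
by rewrite scalerA mulVf // scale1r.
Qed.

Fact qunitP (x y : quat R) : y * x = 1 /\ x * y = 1 -> x != 0.
Proof.
case=> _ xy1; apply/eqP => x0; move: xy1.
by rewrite x0 mul0r => /esym/eqP; rewrite oner_eq0.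
Qed.

Fact qinv_out : {in [predC [pred x : quat R | x != 0]], qinv =1 id}.
Proof.
move=> x; rewrite inE /= negbK => /eqP ->.
by rewrite /qinv (eqP (_ : qdot 0 0 == 0)) ?qdot_eq0 // invr0 scale0r.
Qed.

HB.instance Definition _ := GRing.NzRing_hasMulInverse.Build (quat R)
  qmulVq qmulqV qunitP qinv_out.

Definition imag_sphere : set (quat R) := [set q | q ^+ 2 = - 1].

Definition unit_sphere : set (quat R) := [set q | qnorm q = 1].

(* e^{alpha I}; only meaningful as an exponential when I is in imag_sphere *)
Definition qexp (alpha : R) (I : quat R) : quat R :=
  (cos alpha)%:A + sin alpha *: I.

End quaternion_algebra.

Section slice_regularity.
Context {R : realType}.

Definition slice_pt (I : quat R) (z : R * R) : quat R := z.1%:A + z.2 *: I.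

(* [f] is total, but only its values on [Omega] matter since [Omega] is open.
   Connectedness of [Omega] is not required: the condition is local, and the
   coordinate expression of a map between tori may live on a disconnected open
   set. *)
Definition slice_regular (Omega : set (quat R)) (f : quat R -> quat R) : Prop :=
  open Omega /\
  forall I, imag_sphere I ->
    let fI : R * R -> quat R := f \o slice_pt I in
    forall z : R * R, Omega (slice_pt I z) ->
      [/\ derivable fI z (1, 0) /\ derivable fI z (0, 1),
          {for z, continuous (fun w => 'D_(1, 0) fI w)},
          {for z, continuous (fun w => 'D_(0, 1) fI w)} &
          2^-1 *: ('D_(1, 0) fI z + I * 'D_(0, 1) fI z) = 0].

End slice_regularity.

Section tori.
Context {R : realType}.

Definition zspan (v : 4.-tuple (quat R)) : set (quat R) :=
  [set q | exists n : 'I_4 -> int, q = \sum_i tnth v i *~ n i].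

Record lattice := Lattice {
  lattice_set :> set (quat R);
  lattice_basis : exists2 v : 4.-tuple (quat R), free v & lattice_set = zspan v
}.

Implicit Types L : lattice.

Lemma lattice0 L : lattice_set L 0.
Proof.
have [v _ ->] := lattice_basis L; exists (fun=> 0).
by rewrite big1 // => i _; rewrite mulr0z.
Qed.

Lemma latticeB L x y : lattice_set L x -> lattice_set L y -> lattice_set L (x - y).
Proof.
have [v _ ->] := lattice_basis L => -[n ->] [m ->]; exists (fun i => n i - m i).
by rewrite -sumrB; apply: eq_bigr => i _; rewrite mulrzBr.
Qed.

Definition lattice_rel L : rel (quat R) := fun x y => `[< lattice_set L (x - y) >].

Lemma lattice_rel_refl L : reflexive (lattice_rel L).
Proof. by move=> x; apply/asboolP; rewrite subrr; exact: lattice0. Qed.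

Lemma lattice_rel_sym L : symmetric (lattice_rel L).
Proof.
move=> x y; apply/asboolP/asboolP => Lxy.
  by rewrite -opprB -(sub0r (x - y)); apply: latticeB => //; exact: lattice0.
by rewrite -opprB -(sub0r (y - x)); apply: latticeB => //; exact: lattice0.
Qed.

Lemma lattice_rel_trans L : transitive (lattice_rel L).
Proof.
move=> y x z /asboolP Lxy; rewrite lattice_rel_sym => /asboolP Lzy.
by apply/asboolP; rewrite (_ : x - z = (x - y) - (z - y));
  [exact: latticeB | rewrite opprB addrA subrK].
Qed.

Canonical lattice_equiv L := EquivRel (lattice_rel L)
  (lattice_rel_refl L) (lattice_rel_sym L) (@lattice_rel_trans L).

Definition torus L := quotient_topology {eq_quot lattice_equiv L}.
HB.instance Definition _ L := Topological.on (torus L).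

Definition torus_pi L (q : quat R) : torus L := \pi_{eq_quot lattice_equiv L} q.

(* Domains of charts: the chart attached to [U] is the local inverse
   [torus_chart L U] of [torus_pi L], defined on [torus_pi L @` U]. *)
Definition chart_domain L (U : set (quat R)) : Prop :=
  [/\ open U, connected U & {in U &, injective (torus_pi L)}].

Definition torus_chart L (U : set (quat R)) : torus L -> quat R :=
  'pinv_(fun=> 0) U (torus_pi L).
Arguments torus_chart : clear implicits.

(* The inverse of the chart [torus_chart L U] is [torus_pi L] restricted to
   [U], so the expression of F in the charts attached to U and V sends q to
   [torus_chart L' V (F (torus_pi L q))].  Continuity is part of the notion: it
   makes the domain of this expression open. *)
Definition regular_map L L' (F : torus L -> torus L') : Prop :=
  continuous F /\
  forall U V, chart_domain L U -> chart_domain L' V ->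
    slice_regular (U `&` (F \o torus_pi L) @^-1` (torus_pi L' @` V))
                  (torus_chart L' V \o F \o torus_pi L).

Definition torus_equivalent L L' : Prop :=
  exists (F : torus L -> torus L') (G : torus L' -> torus L),
    [/\ cancel F G, cancel G F, regular_map F & regular_map G].

(* Automorphisms are recorded by their lifts to the quaternions. *)
Definition torus_aut L : set (quat R -> quat R) :=
  [set F | exists2 a, unit_sphere a & F = (fun q => q * a) /\ F @` L = L].

Definition gram (v : 4.-tuple (quat R)) : 'M[R]_4 :=
  \matrix_(i, j) qdot (tnth v i) (tnth v j).

Definition reduced (M : 'M[R]_4) : Prop :=
  (forall k l : 'I_4, l = k.+1 :> nat -> 0 <= M k l) /\
  (forall (k : 'I_4) (n : 'rV[int]_4),
     \big[gcdz/0]_(i < 4 | (k <= i)%N) n 0 i = 1 ->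
     let nR : 'rV[R]_4 := map_mx intr n in
     M k k <= (nR *m M *m nR^T) 0 0).

Definition special_basis (v : 4.-tuple (quat R)) : Prop :=
  [/\ free v, reduced (gram v) & tnth v 0 = 1].

Definition moduli_set : set (quat R * quat R * quat R) :=
  [set v | special_basis [tuple 1; v.1.1; v.1.2; v.2]].

Definition is_modulus L (v : quat R * quat R * quat R) : Prop :=
  moduli_set v /\
  exists L' : lattice,
    L' = zspan [tuple 1; v.1.1; v.1.2; v.2] :> set (quat R) /\
    torus_equivalent L L'.

Definition sphere_subgroup (G : set (quat R)) : Prop :=
  [/\ G `<=` unit_sphere, G 1, forall x y, G x -> G y -> G (x * y) &
      forall x, G x -> G x^-1].

(* 2D_6, for orthogonal I and J in imag_sphere *)
Definition dic6 (I J : quat R) : set (quat R) :=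
  smallest sphere_subgroup [set qexp (pi / 3) I; J].

End tori.

Arguments lattice : clear implicits.

Definition group_isomorphic (X Y : Type) (A : set X) (mulA : X -> X -> X)
    (B : set Y) (mulB : Y -> Y -> Y) : Prop :=
  exists2 phi : X -> Y, set_bij A B phi &
    {in A &, {morph phi : x y / mulA x y >-> mulB x y}}.

(* Main.v *)
Require Import Defs.
From HB Require Import structures.
From mathcomp Require Import all_boot all_order all_algebra.
From mathcomp Require Import all_classical all_reals all_analysis.
From mathcomp Require Import ring lra zify.

(** The automorphisms of H / L are the right multiplications by unit quaternions that
    preserve L, so both sides of the equivalence speak of right module structures on L.

    Let w = e^(pi I / 3) and let O = Z [w] + J Z [w] be the ring spanned by the hexagonal
    basis 1, w, J, J w. It is an orthogonal sum of two hexagonal lattices; its norm form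
    is the integral form k^2 + kl + l^2 + m^2 + mn + n^2. The elements of norm 1 are
    twelve, and they make up the group generated by w and J (dic6E). Every quaternion is at
    squared distance at most 7/8 from O (hexorder_rounding), so O is Euclidean.

    Suppose that the automorphism group is isomorphic to that group. The relations between
    the generators hold for two unit quaternions a and b that preserve L, and put them in
    the form a = w and b = J for suitable I and J (hex_relations). So L is a right O-module,
    and Euclidean division by a nearly shortest element makes it principal: L = x O
    (lattice_principal). Right multiplication by x^-1 maps L onto x O x^-1, the order
    attached to the conjugates of I and J, and its hexagonal basis is reduced
    (hex_moduli).

    Conversely, suppose that H / L is equivalent to H / O. An equivalence between tori is
    induced by an affine map q |-> q a + b (regular_torus_map_affine). Indeed, for a
    small h, the increment from q to q + h has a unique small representative in H. This is a
    bounded function of q, regular on the slice containing h, so by the theorem of Liouville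
    it is constant along this slice (slice_increments). Thus the map is
    additive, and then linear, on each slice, with a coefficient that is determined on the
    real axis common to all slices. It follows that L c = O for some c
    (equivalent_right_scaling), and conjugation by c identifies the automorphisms of L with
    the units of O. The two groups of units attached to the pairs (I, J) and (I0, J0)
    correspond under the automorphism of H that carries one pair to the other (frameM). *)

Set Implicit Arguments.
Unset Strict Implicit.
Unset Printing Implicit Defensive.

Import Order.TTheory GRing.Theory Num.Theory.
Import numFieldNormedType.Exports.
Local Open Scope classical_set_scope.
Local Open Scope ring_scope.

(** * Calculus in the plane *)

Section planar_calculus.
Context {R : realType}.
Implicit Types (u v : R * R -> R) (z : R * R).

(** Difference quotients are taken on both sides of a point, hence the end points
    in either order. *)
Lemma mvt_between (f df : R -> R) (x y : R) :
  (forall t, is_derive t (1 : R) f (df t)) ->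
  exists2 c, `|c - x| <= `|y - x| & f y - f x = df c * (y - x).
Proof.
move=> fdf.
have fcont : continuous f.
  by move=> t; apply/differentiable_continuous/derivable1_diffP; case: (fdf t).
have [xy|yx] := leP x y.
  have [c] := @MVT_segment R f df x y xy (fun t _ => fdf t)
    (continuous_subspaceT fcont).
  rewrite in_itv /= => /andP[xc cy] ->; exists c => //.
  by rewrite !ger0_norm ?subr_ge0 ?lerD2r.
have [c] := @MVT_segment R f df y x (ltW yx) (fun t _ => fdf t)
    (continuous_subspaceT fcont).
rewrite in_itv /= => /andP[yc cx] e; exists c.
  by rewrite !ler0_norm ?subr_le0 ?(ltW yx)// !opprB lerD2l lerN2.
by rewrite -[LHS]opprB e -mulrN opprB.
Qed.

(** A derivative in the direction w is the derivative of the restriction to a line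
    directed by w. *)
Lemma is_derive_line {W : normedModType R} (f : R * R -> W) z w df (g : R -> W) (t : R) :
  (forall h : R, g (h + t) = f (h *: w + z)) ->
  is_derive z w f df -> is_derive t (1 : R) g df.
Proof.
move=> gE [dfz <-].
have E : (fun h : R => h^-1 *: ((g \o shift t) (h *: (1 : R)) - g t)) =
         (fun h : R => h^-1 *: ((f \o shift z) (h *: w) - f z)).
  apply/funext => h /=; rewrite /shift /= -gE -[g t]/(g t).
  have := gE 0; rewrite add0r scale0r add0r => ->.
  by rewrite -[h *: (1 : R)]/(h * 1) mulr1 gE.
split; first by rewrite /derivable E.
by rewrite /derive E.
Qed.

(** Chain rule along a plane curve. Only continuous partial derivatives are at hand,
    not a total derivative, and the mean value theorem on an axis-parallel broken line
    makes up for it. *)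
Lemma is_derive_chain2 u (ux uy : R * R -> R) (a b : R -> R) (t a' b' : R) :
  (forall z, is_derive z ((1, 0) : R * R) u (ux z)) ->
  (forall z, is_derive z ((0, 1) : R * R) u (uy z)) ->
  continuous ux -> continuous uy ->
  is_derive t (1 : R) a a' -> is_derive t (1 : R) b b' ->
  is_derive t (1 : R) (fun s => u (a s, b s)) (ux (a t, b t) * a' + uy (a t, b t) * b').
Proof.
move=> dux duy cux cuy da db.
have dx y x : is_derive x (1 : R) (fun x => u (x, y)) (ux (x, y)).
  apply: is_derive_line (dux (x, y)) => h.
  by congr (u (_, _)); rewrite /= -?[_ *: _]/(_ * _) ?mulr1// mulr0 add0r.
have dy x y : is_derive y (1 : R) (fun y => u (x, y)) (uy (x, y)).
  apply: is_derive_line (duy (x, y)) => h.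
  by congr (u (_, _)); rewrite /= -?[_ *: _]/(_ * _) ?mulr1// mulr0 add0r.
(* The increment of u is taken along a horizontal and then a vertical segment;
   xi and eta are the intermediate points on the two segments. *)
have /choice[xi xiP] h : exists c, `|c - a t| <= `|a (h + t) - a t| /\
    u (a (h + t), b (h + t)) - u (a t, b (h + t)) =
    ux (c, b (h + t)) * (a (h + t) - a t).
  by have [c ? ?] := @mvt_between _ _ (a t) (a (h + t)) (dx (b (h + t))); exists c.
have /choice[eta etaP] h : exists c, `|c - b t| <= `|b (h + t) - b t| /\
    u (a t, b (h + t)) - u (a t, b t) = uy (a t, c) * (b (h + t) - b t).
  by have [c ? ?] := @mvt_between _ _ (b t) (b (h + t)) (dy (a t)); exists c.
have cvg_shift (f : R -> R) f' : is_derive t (1 : R) f f' ->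
    f (h + t) @[h --> 0^'] --> f t.
  move=> [df _].
  have cf : {for t, continuous f}.
    exact/differentiable_continuous/derivable1_diffP.
  have ct : (h + t) @[h --> (0 : R)] --> 0 + t.
    by apply: cvgD; [exact: cvg_id | exact: cvg_cst].
  rewrite add0r in ct.
  by apply: (cvg_comp (fun h => h + t) f _ cf); exact: cvg_within_filter ct.
have cvg_near (f c : R -> R) f' : is_derive t (1 : R) f f' ->
    (forall h, `|c h - f t| <= `|f (h + t) - f t|) -> c h @[h --> 0^'] --> f t.
  move=> df cle; have /cvgrPdist_lt cf := cvg_shift f f' df.
  apply/cvgrPdist_lt => e e0; near=> h.
  rewrite distrC; apply: le_lt_trans (cle h) _; rewrite distrC.
  by near: h; exact: cf.
have cxi := cvg_near _ _ _ da (fun h => (xiP h).1).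
have ceta := cvg_near _ _ _ db (fun h => (etaP h).1).
have cb := cvg_shift _ _ db.
have Lx : ux (xi h, b (h + t)) @[h --> 0^'] --> ux (a t, b t).
  apply: (@continuous2_cvg _ _ _ _ _ _ xi (fun h => b (h + t)) (fun x y => ux (x, y))) cxi cb.
  by apply: cvg_trans (cux (a t, b t)); apply: near_eq_cvg; apply: nearW; case.
have Ly : uy (a t, eta h) @[h --> 0^'] --> uy (a t, b t).
  apply: (@continuous2_cvg _ _ _ _ _ _ (fun=> a t) eta (fun x y => uy (x, y))) (cvg_cst _) ceta.
  by apply: cvg_trans (cuy (a t, b t)); apply: near_eq_cvg; apply: nearW; case.
have quot (f : R -> R) f' : is_derive t (1 : R) f f' ->
    h^-1 * (f (h + t) - f t) @[h --> 0^'] --> f'.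
  move=> [/cvg_ex[l fl] <-]; rewrite /derive (cvg_lim _ fl)//.
  apply: cvg_trans fl; apply: near_eq_cvg; near=> h => /=.
  by rewrite /shift /= -[h *: (1 : R)]/(h * 1) mulr1.
have L := cvgD (cvgM Lx (quot _ _ da)) (cvgM Ly (quot _ _ db)).
have key : h^-1 *: (((fun s => u (a s, b s)) \o shift t) (h *: (1 : R)) - u (a t, b t))
    @[h --> 0^'] --> ux (a t, b t) * a' + uy (a t, b t) * b'.
  have E h : ux (xi h, b (h + t)) * (h^-1 * (a (h + t) - a t)) +
      uy (a t, eta h) * (h^-1 * (b (h + t) - b t)) =
      h^-1 *: (((fun s => u (a s, b s)) \o shift t) (h *: (1 : R)) - u (a t, b t)).
    rewrite -[h *: (1 : R)]/(h * 1) mulr1 /shift /=.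
    rewrite mulrCA -(xiP h).2 [uy _ * _]mulrCA -(etaP h).2.
    by rewrite -mulrDr addrA subrK.
  by rewrite -(eq_cvg _ _ E); exact: L.
split; first by apply/cvg_ex; exists (ux (a t, b t) * a' + uy (a t, b t) * b').
by rewrite /derive; apply/cvg_lim.
Unshelve. all: by end_near. Qed.

End planar_calculus.

(** * Integrals with a parameter and the theorem of Liouville *)

Section parametric_integral.
Context {R : realType}.
Local Notation mu := (@lebesgue_measure R).

Lemma continuous_integrable_itv (f : R -> R) (a b : R) : continuous f ->
  mu.-integrable `[a, b] (EFin \o f).
Proof.
move=> cf; apply: continuous_compact_integrable; first exact: segment_compact.
exact: continuous_subspaceT.
Qed.

Lemma FTC2_everywhere (F f : R -> R) (a b : R) : a < b -> continuous f ->
  (forall t, is_derive t (1 : R) F (f t)) ->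
  \int[mu]_(t in `[a, b]) f t = F b - F a.
Proof.
move=> ab cf dF.
have cF : continuous F.
  by move=> t; apply/differentiable_continuous/derivable1_diffP; case: (dF t).
rewrite /Rintegral (@continuous_FTC2 _ f F)//.
- exact: continuous_subspaceT.
- split; first by move=> t _; case: (dF t).
  + exact: cvg_at_right_filter (cF a).
  + exact: cvg_at_left_filter (cF b).
- by move=> t _; rewrite derive1E; case: (dF t).
Qed.

(** Differentiation under the integral sign. On a compact box the continuous
    derivative is bounded by a constant, which serves as the dominating function. *)
Lemma is_derive_integral (f df : R -> R -> R) (a c d : R) :
  (forall r t, is_derive r (1 : R) (f^~ t) (df r t)) ->
  (forall r, continuous (f r)) ->
  continuous (fun z : R * R => df z.1 z.2) ->
  is_derive a (1 : R) (fun r => \int[mu]_(t in `[c, d]) f r t)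
                      (\int[mu]_(t in `[c, d]) df a t).
Proof.
move=> fdf cf cdf.
have dfE r t : partial1of2 f r t = df r t.
  by rewrite partial1of2E; case: (fdf r t).
(* M dominates the derivative for parameters within 1 of a. *)
have [M M0 Mub] : exists2 M : R, 0 <= M &
    forall r t, `]a - 1, a + 1[%classic r -> `[c, d]%classic t -> `|df r t| <= M.
  have cpt : compact (`[a - 1, a + 1]%classic `*` `[c, d]%classic).
    by apply: compact_setX; exact: segment_compact.
  have /compact_bounded[M0 [_ bM]] :=
    continuous_compact (continuous_subspaceT cdf) cpt.
  exists (`|M0| + 1) => [|r t]; first by rewrite addr_ge0.
  rewrite /= !in_itv /= => /andP[/ltW ar /ltW ra] ct.
  apply: (bM (`|M0| + 1)); first by rewrite ltr_pwDr// ler_norm.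
  by exists (r, t) => //; split; rewrite /= in_itv /= ?ar.
have Ia : `]a - 1, a + 1[%classic a.
  by rewrite /= in_itv /= ltrDl ltrBlDr ltrDl ltr01.
have iG : mu.-integrable `[c, d] (EFin \o cst M).
  by apply: continuous_integrable_itv; exact: cst_continuous.
have intf x : `]a - 1, a + 1[%classic x -> mu.-integrable `[c, d] (EFin \o f x).
  by move=> _; exact: continuous_integrable_itv.
have df1 x y : `]a - 1, a + 1[%classic x -> `[c, d]%classic y ->
    derivable (f^~ y) x 1 by move=> _ _; case: (fdf x y).
have Gub x y : `]a - 1, a + 1[%classic x -> `[c, d]%classic y ->
    `|partial1of2 f x y| <= cst M y by rewrite dfE; exact: Mub.
have m : measurable (`[c, d]%classic : set R) by exact: measurable_itv.
have D := @derivable_under_integral R _ _ mu f `[c, d]%classic m a (a - 1) (a + 1)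
  Ia intf df1 (cst M) (fun=> M0) iG Gub.
have DE := @differentiation_under_integral R _ _ mu f `[c, d]%classic m a (a - 1)
  (a + 1) Ia intf df1 (cst M) (fun=> M0) iG Gub.
split; first exact: D.
rewrite -derive1E DE.
by apply: eq_Rintegral => t _; rewrite dfE.
Qed.

End parametric_integral.

Section liouville.
Context {R : realType}.
Implicit Types (u v : R * R -> R) (z : R * R).
Local Notation mu := (@lebesgue_measure R).

(** Liouville's theorem for f = u + iv. Let phi (r) be the real part of the
    integral of e^(-it) f (z + r e^(it)) over a period, and m (r) that of
    u_x (z + r e^(it)). The Cauchy-Riemann equations give phi' = m, and integration by
    parts in t gives phi = r m. So phi is linear on the positive reals; being bounded it
    vanishes there, and 0 = phi' (0) = m (0) = 2 pi u_x (z). *)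
Lemma bounded_cauchy_riemann u v (ux uy : R * R -> R) (K : R) :
  (forall z, is_derive z ((1, 0) : R * R) u (ux z)) ->
  (forall z, is_derive z ((0, 1) : R * R) u (uy z)) ->
  (forall z, is_derive z ((1, 0) : R * R) v (- uy z)) ->
  (forall z, is_derive z ((0, 1) : R * R) v (ux z)) ->
  continuous ux -> continuous uy ->
  (forall z, `|u z| <= K) -> (forall z, `|v z| <= K) ->
  forall z, ux z = 0.
Proof.
move=> dux duy dvx dvy cux cuy uK vK [x0 y0].
have cNuy : continuous (fun z => - uy z) by move=> z; apply: cvgN; exact: cuy.
pose P (r t : R) : R * R := (x0 + r * cos t, y0 + r * sin t).
have dcos (r t : R) : is_derive t (1 : R) (fun t => x0 + r * cos t) (- (r * sin t)).
  have h := is_deriveD (is_derive_cst x0 t (1 : R)) (is_deriveZ r (is_derive_cos t)).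
  by apply: (is_derive_eq h); rewrite add0r -[_ *: _]/(_ * _) mulrN.
have dsin (r t : R) : is_derive t (1 : R) (fun t => y0 + r * sin t) (r * cos t).
  have h := is_deriveD (is_derive_cst y0 t (1 : R)) (is_deriveZ r (is_derive_sin t)).
  by apply: (is_derive_eq h); rewrite add0r.
have drad (c k r : R) : is_derive r (1 : R) (fun r => c + r * k) k.
  have h := is_deriveD (is_derive_cst c r (1 : R)) (is_deriveZ k (is_derive_id r (1 : R))).
  rewrite add0r -[_ *: _]/(_ * _) mulr1 in h.
  by congr (is_derive _ _ _ _) : h; apply/funext => s /=; rewrite [s * k]mulrC.
have dt (w wx wy : R * R -> R) : (forall z, is_derive z ((1, 0) : R * R) w (wx z)) ->
    (forall z, is_derive z ((0, 1) : R * R) w (wy z)) ->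
    continuous wx -> continuous wy -> forall r t, is_derive t (1 : R)
      (fun t => w (P r t)) (r * (wy (P r t) * cos t - wx (P r t) * sin t)).
  move=> dwx dwy cwx cwy r t.
  have := is_derive_chain2 dwx dwy cwx cwy (dcos r t) (dsin r t).
  by move/is_derive_eq; apply; rewrite /P; ring.
have dr (w wx wy : R * R -> R) : (forall z, is_derive z ((1, 0) : R * R) w (wx z)) ->
    (forall z, is_derive z ((0, 1) : R * R) w (wy z)) ->
    continuous wx -> continuous wy -> forall r t, is_derive r (1 : R)
      (fun r => w (P r t)) (wx (P r t) * cos t + wy (P r t) * sin t).
  move=> dwx dwy cwx cwy r t.
  exact: is_derive_chain2 dwx dwy cwx cwy (drad x0 (cos t) r) (drad y0 (sin t) r).
pose f r t := u (P r t) * cos t + v (P r t) * sin t.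
pose df r t := ux (P r t).
pose phi r := \int[mu]_(t in `[0, pi *+ 2]) f r t.
pose m r := \int[mu]_(t in `[0, pi *+ 2]) df r t.
have tpi_gt0 : 0 < pi *+ 2 :> R by rewrite mulrn_wgt0 ?pi_gt0.
have cont_is_derive (g dg : R -> R) :
    (forall t, is_derive t (1 : R) g (dg t)) -> continuous g.
  by move=> dg' t; apply/differentiable_continuous/derivable1_diffP; case: (dg' t).
have cuP r : continuous (fun t => u (P r t)) :=
  cont_is_derive _ _ (dt _ _ _ dux duy cux cuy r).
have cvP r : continuous (fun t => v (P r t)) :=
  cont_is_derive _ _ (dt _ _ _ dvx dvy cNuy cux r).
have cdf : continuous (fun z : R * R => df z.1 z.2).
  move=> z; rewrite /df /P.
  apply: (@continuous2_cvg _ _ _ _ _ _ (fun z : R * R => x0 + z.1 * cos z.2)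
    (fun z : R * R => y0 + z.1 * sin z.2) (fun x y => ux (x, y))).
  - by apply: cvg_trans (cux _); apply: near_eq_cvg; apply: nearW; case.
  - apply: cvgD; first exact: cvg_cst.
    apply: cvgM; first exact: cvg_fst.
    by apply: continuous_cvg; [exact: continuous_cos | exact: cvg_snd].
  - apply: cvgD; first exact: cvg_cst.
    apply: cvgM; first exact: cvg_fst.
    by apply: continuous_cvg; [exact: continuous_sin | exact: cvg_snd].
have cdfr r : continuous (df r).
  move=> t; apply: (@continuous2_cvg _ _ _ _ _ _ (fun=> r) id df) => //.
  - exact: (cdf (r, t)).
  - exact: cvg_cst.
have cf r : continuous (f r).
  by move=> t; apply: cvgD; apply: cvgM => //;
    [exact: cuP | exact: continuous_cos | exact: cvP | exact: continuous_sin].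
(* The radial derivative of f is u_x, by the Cauchy-Riemann equations. *)
have fdf r t : is_derive r (1 : R) (f^~ t) (df r t).
  have du := dr _ _ _ dux duy cux cuy r t.
  have dv := dr _ _ _ dvx dvy cNuy cux r t.
  have h := is_deriveD (is_deriveZ (cos t) du) (is_deriveZ (sin t) dv).
  have E : cos t *: (ux (P r t) * cos t + uy (P r t) * sin t) +
      sin t *: (- uy (P r t) * cos t + ux (P r t) * sin t) = df r t.
    rewrite -2![_ *: _]/(_ * _) /df -[RHS]mulr1 -(cos2Dsin2 t); ring.
  rewrite E in h; congr (is_derive _ _ _ _) : h; apply/funext => s; rewrite /f.
  by congr (_ + _); rewrite mulrC.
have dphi r : is_derive r (1 : R) phi (m r) by exact: is_derive_integral.
(* H is the part of the angular integration by parts that is evaluated at the end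
   points, where it takes equal values by periodicity. *)
have phiE r : phi r = r * m r.
  pose H t := u (P r t) * sin t - v (P r t) * cos t.
  have dH t : is_derive t (1 : R) H (f r t - r * df r t).
    have du := dt _ _ _ dux duy cux cuy r t.
    have dv := dt _ _ _ dvx dvy cNuy cux r t.
    have h := is_deriveB (is_deriveM du (is_derive_sin t)) (is_deriveM dv (is_derive_cos t)).
    apply: (is_derive_eq h); rewrite -4![_ *: _]/(_ * _) /f /df.
    rewrite -[in RHS](mulr1 (ux _)) -(cos2Dsin2 t); ring.
  have cdH : continuous (fun t => f r t - r * df r t).
    by move=> t; apply: cvgB; [exact: cf | apply: cvgM; [exact: cvg_cst | exact: cdfr]].
  have := FTC2_everywhere tpi_gt0 cdH dH.
  rewrite /H sin0 cos0 !mulr0 !mulr1 !sub0r.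
  have -> : sin (pi *+ 2) = 0 :> R by exact: (sin2pi R).
  have -> : cos (pi *+ 2) = 1 :> R by exact: (cos2pi R).
  have -> : P r (pi *+ 2) = P r 0.
    by rewrite /P sin2pi cos2pi sin0 cos0.
  rewrite mulr0 mulr1 sub0r subrr.
  rewrite RintegralB//; last 2 first.
  - exact: continuous_integrable_itv.
  - apply: continuous_integrable_itv => t.
    by apply: cvgM; [exact: cvg_cst | exact: cdfr].
  rewrite RintegralZl//; last exact: continuous_integrable_itv.
  by move/eqP; rewrite subr_eq0 => /eqP.
have [M phi_bound] : exists M, forall r, `|phi r| <= M.
  exists (\int[mu]_(t in `[0, pi *+ 2]) (K + K)) => r.
  have mI : measurable (`[0, pi *+ 2]%classic : set R) by exact: measurable_itv.
  have cnf : continuous (fun t => `|f r t|).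
    by move=> t; apply: cvg_norm; exact: cf.
  have step : `|phi r| <= \int[mu]_(t in `[0, pi *+ 2]) `|f r t|.
    by apply: le_normr_Rintegral => //; exact: continuous_integrable_itv.
  apply: (le_trans step).
  apply: le_Rintegral => //.
  - exact: continuous_integrable_itv cnf.
  - by apply: continuous_integrable_itv; exact: cst_continuous.
  move=> t _; rewrite /f; apply: le_trans (ler_normD _ _) _; rewrite !normrM.
  apply: lerD.
    rewrite -[leRHS]mulr1; apply: ler_pM => //.
    by rewrite ler_norml cos_geN1 cos_le1.
  rewrite -[leRHS]mulr1; apply: ler_pM => //.
  by rewrite ler_norml sin_geN1 sin_le1.
(* phi solves phi = r phi', so phi (e^s) e^(-s) is constant in s: phi is linear on
   the positive reals, and it is bounded. *)
have phi0 r : 0 < r -> phi r = 0.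
  move=> r0; pose chi s := phi (expR s) * expR (- s).
  have dchi s : is_derive s (1 : R) chi 0.
    have d1 := is_derive1_comp (dphi (expR s)) (is_derive_expR s).
    have d2 := is_derive1_comp (is_derive_expR (- s)) (is_deriveNid s (1 : R)).
    apply: (is_derive_eq (is_deriveM d1 d2)).
    rewrite -2![_ *: _]/(_ * _) /= phiE expRN mulrN1 mulrN.
    by rewrite [_ * m _]mulrC [X in _ + X]mulrC addNr.
  have lin t : 0 < t -> phi t = phi 1 * t.
    move=> t0; have := is_derive_0_is_cst (ln t) 0 dchi.
    rewrite /chi oppr0 expR0 mulr1 expRN lnK ?posrE// => <-.
    by rewrite divfK ?gt_eqF.
  have [e|ne] := eqVneq (phi 1) 0; first by rewrite lin// e mul0r.
  have M0 : 0 <= M by exact: le_trans (phi_bound 0).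
  have t0 : 0 < (M + 1) / `|phi 1| by rewrite divr_gt0 ?normr_gt0// ltr_wpDl.
  have := phi_bound ((M + 1) / `|phi 1|).
  rewrite lin// normrM (gtr0_norm t0) mulrC divfK ?normr_eq0//.
  by rewrite leNgt ltrDl ltr01.
(* m 0 is the derivative of phi at 0, computed here from the right. *)
have m0 : m 0 = 0.
  have p0 : phi 0 = 0 by rewrite phiE mul0r.
  have [/cvg_ex[l dl] e] := dphi 0.
  have lm : l = m 0 by rewrite -e /derive (cvg_lim _ dl).
  rewrite -lm.
  have dr0 : h^-1 *: ((phi \o shift 0) (h *: (1 : R)) - phi 0) @[h --> 0^'+] --> l.
    exact: cvg_dnbhs_at_right.
  apply/esym/(cvg_unique _ _ dr0) => //; last first.
  apply: (@cvg_trans _ ((fun _ : R => 0 : R) @ 0^'+)); last exact: cvg_cst.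
  apply: near_eq_cvg; near=> h.
  have h0 : 0 < h by near: h; exact: nbhs_right_gt.
  by rewrite /= /shift p0 addr0 -[h *: (1 : R)]/(h * 1) mulr1 phi0// subr0 scaler0.

have : m 0 = ux (x0, y0) * (pi *+ 2).
  rewrite /m /df; under eq_Rintegral do rewrite /P !mul0r !addr0.
  rewrite Rintegral_cst//= lebesgue_measure_itv /=.
  by rewrite lte_fin tpi_gt0 oppr0 adde0.
rewrite m0 => /esym/eqP; rewrite mulf_eq0 (gt_eqF tpi_gt0) orbF => /eqP.
by [].
Unshelve. all: by end_near. Qed.
End liouville.

(** * Quaternions in coordinates *)

Lemma lipschitz_continuous {R : realType} {V W : normedModType R} (f : V -> W)
    (k : R) : (forall x y, `|f x - f y| <= k * `|x - y|) -> continuous f.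
Proof.
move=> fk x; apply/cvgrPdist_le => e e0.
have k1 : 0 < `|k| + 1 by rewrite ltr_wpDl.
near=> y; apply: le_trans (fk _ _) _.
apply: (@le_trans _ _ ((`|k| + 1) * `|x - y|)).
  by rewrite ler_wpM2r// (le_trans (ler_norm k))// lerDl.
rewrite -ler_pdivlMl//; near: y.
by apply: cvgr_dist_le; rewrite ?mulr_gt0 ?invr_gt0.
Unshelve. all: by end_near. Qed.

Section quaternion_coordinates.
Context {R : realType}.
Implicit Types x y z : quat R.

Lemma qreN x : qre (- x) = - qre x. Proof. exact: mxE. Qed.
Lemma qiN x : qi (- x) = - qi x. Proof. exact: mxE. Qed.
Lemma qjN x : qj (- x) = - qj x. Proof. exact: mxE. Qed.
Lemma qkN x : qk (- x) = - qk x. Proof. exact: mxE. Qed.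
Lemma qre0 : qre (0 : quat R) = 0. Proof. exact: mxE. Qed.
Lemma qi0 : qi (0 : quat R) = 0. Proof. exact: mxE. Qed.
Lemma qj0 : qj (0 : quat R) = 0. Proof. exact: mxE. Qed.
Lemma qk0 : qk (0 : quat R) = 0. Proof. exact: mxE. Qed.
Lemma qre1 : qre (1 : quat R) = 1. Proof. exact: qreE. Qed.
Lemma qi1 : qi (1 : quat R) = 0. Proof. exact: qiE. Qed.
Lemma qj1 : qj (1 : quat R) = 0. Proof. exact: qjE. Qed.
Lemma qk1 : qk (1 : quat R) = 0. Proof. exact: qkE. Qed.
Lemma qreM x y :
  qre (x * y) = qre x * qre y - qi x * qi y - qj x * qj y - qk x * qk y.
Proof. exact: qreE. Qed.
Lemma qiM x y :
  qi (x * y) = qre x * qi y + qi x * qre y + qj x * qk y - qk x * qj y.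
Proof. exact: qiE. Qed.
Lemma qjM x y :
  qj (x * y) = qre x * qj y - qi x * qk y + qj x * qre y + qk x * qi y.
Proof. exact: qjE. Qed.
Lemma qkM x y :
  qk (x * y) = qre x * qk y + qi x * qj y - qj x * qi y + qk x * qre y.
Proof. exact: qkE. Qed.

Definition qopE := (qreN, qiN, qjN, qkN, qre0, qi0, qj0, qk0, qre1, qi1, qj1, qk1,
  qreM, qiM, qjM, qkM, @qcoordE R).

Lemma qdotC x y : qdot x y = qdot y x.
Proof. by rewrite !qdotE; ring. Qed.
Lemma qdotDl x y z : qdot (x + y) z = qdot x z + qdot y z.
Proof. by rewrite !qdotE !qopE; ring. Qed.
Lemma qdotDr x y z : qdot z (x + y) = qdot z x + qdot z y.
Proof. by rewrite !qdotE !qopE; ring. Qed.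
Lemma qdotNr x y : qdot y (- x) = - qdot y x.
Proof. by rewrite !qdotE !qopE; ring. Qed.
Lemma qdotZl a x y : qdot (a *: x) y = a * qdot x y.
Proof. by rewrite !qdotE !qopE; ring. Qed.
Lemma qdotZr a x y : qdot y (a *: x) = a * qdot y x.
Proof. by rewrite !qdotE !qopE; ring. Qed.
Lemma qdot_ge0 x : 0 <= qdot x x.
Proof. by rewrite qdotE !addr_ge0// -expr2 sqr_ge0. Qed.
Lemma qdot_gt0 x : x != 0 -> 0 < qdot x x.
Proof. by move=> x0; rewrite lt_def qdot_ge0 qdot_eq0 x0. Qed.
Lemma qdotM x y : qdot (x * y) (x * y) = qdot x x * qdot y y.
Proof. by rewrite !qdotE !qopE; ring. Qed.
Lemma qdot0r x : qdot x 0 = 0.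
Proof. by rewrite qdotE !qopE; ring. Qed.
Lemma qdot11 : qdot 1 1 = 1 :> R.
Proof. by rewrite qdotE !qopE; ring. Qed.
Lemma qdotMl x y z : qdot (z * x) (z * y) = qdot z z * qdot x y.
Proof. by rewrite !qdotE !qopE; ring. Qed.
Lemma qmul_eq0 x y : (x * y == 0) = (x == 0) || (y == 0).
Proof. by rewrite -!qdot_eq0 qdotM mulf_eq0. Qed.

Lemma qconjM x y : qconj (x * y) = qconj y * qconj x.
Proof. by apply: quatP; rewrite /qconj !qopE; ring. Qed.

Lemma qconjK x : qconj (qconj x) = x.
Proof. by apply: quatP; rewrite /qconj !qopE; ring. Qed.

Lemma qconjD x y : qconj (x + y) = qconj x + qconj y.
Proof. by apply: quatP; rewrite /qconj !qopE; ring. Qed.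

Lemma qconjZ (a : R) x : qconj (a *: x) = a *: qconj x.
Proof. by apply: quatP; rewrite /qconj !qopE; ring. Qed.

Lemma qconj1 : qconj (1 : quat R) = 1.
Proof. by apply: quatP; rewrite /qconj !qopE; ring. Qed.

Lemma qdot_conj x : qdot (qconj x) (qconj x) = qdot x x.
Proof. by rewrite !qdotE /qconj !qopE; ring. Qed.

Lemma qinv_unit x : qdot x x = 1 -> x^-1 = qconj x.
Proof. by move=> x1; rewrite /GRing.inv /= /qinv x1 invr1 scale1r. Qed.

(** The imaginary part of x^2 is twice the real part times the imaginary part of x; if
    the real part were not zero, x would be real and x^2 positive. *)
Lemma imag_sphereP x : imag_sphere x <-> qre x = 0 /\ qdot x x = 1.
Proof.
split; last first.
  move=> [x0]; rewrite qdotE x0 => x1; apply: quatP;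
    rewrite /= expr2 !qopE x0; try ring.
  by rewrite -[in RHS]x1; ring.
rewrite /imag_sphere /= expr2 => /[dup] /[dup] /[dup].
move=> /(congr1 (@qre R)) + /(congr1 (@qi R)) + /(congr1 (@qj R)) + /(congr1 (@qk R)).
rewrite !qopE qdotE; set a := qre x; set b := qi x; set c := qj x; set d := qk x.
move=> ea eb ec ed.
have [a0|a0] := eqVneq a 0.
  by split => //; move: ea; rewrite a0; lra.
have b0 : a * b == 0 by apply/eqP; move: eb; lra.
have c0 : a * c == 0 by apply/eqP; move: ec; lra.
have d0 : a * d == 0 by apply/eqP; move: ed; lra.
move: b0 c0 d0; rewrite !mulf_eq0 (negbTE a0) /= => /eqP b0 /eqP c0 /eqP d0.
by move: ea; rewrite b0 c0 d0; nra.
Qed.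

Lemma unit_sphereP x : unit_sphere x <-> qdot x x = 1.
Proof.
rewrite /unit_sphere /= /qnorm; split => [|->]; last exact: sqrtr1.
by move=> /(congr1 (fun t => t ^+ 2)); rewrite sqr_sqrtr ?qdot_ge0// expr1n.
Qed.

Lemma qdot_imagM I x y : imag_sphere I -> qdot x (I * y) = - qdot (I * x) y.
Proof. by move=> /imag_sphereP[I0 _]; rewrite !qdotE !qopE I0; ring. Qed.

Lemma qconj_imag (I : quat R) : imag_sphere I -> qconj I = - I.
Proof.
by move=> /imag_sphereP[I0 _]; apply: quatP; rewrite /qconj !qopE ?I0; ring.
Qed.

Lemma imag_sphere_mulK I : imag_sphere I -> forall x, I * (I * x) = - x.
Proof. by move=> hI x; rewrite mulrA -expr2 hI mulN1r. Qed.

Lemma coord_le_norm x (i : 'I_4) : `|(x : 'rV[R]_4) 0 i| <= `|x|.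
Proof.
by rewrite [leRHS]/Num.norm /= mx_normrE; apply/bigmax_geP; right => /=; exists (0, i).
Qed.

Lemma norm_quat_le x (e : R) : (forall i : 'I_4, `|(x : 'rV[R]_4) 0 i| <= e) ->
  `|x| <= e.
Proof.
move=> xe; rewrite [leLHS]/Num.norm /= mx_normrE; apply/bigmax_leP; split => [|[j i] _ /=].
  by apply: le_trans (xe 0).
by rewrite ord1.
Qed.

Lemma norm_qdot_le x y : `|qdot x y| <= 4 * `|x| * `|y|.
Proof.
rewrite /qdot; apply: le_trans (ler_norm_sum _ _ _) _.
apply: (@le_trans _ _ (\sum_(i < 4) (`|x| * `|y|))).
  by apply: ler_sum => i _; rewrite normrM ler_pM ?coord_le_norm.
by rewrite sumr_const card_ord -[leLHS]mulr_natl !mulrA.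
Qed.

(** Compares the sup norm, which defines the topology, with the Euclidean one. *)
Lemma sqr_norm_le_qdot x : `|x| ^+ 2 <= qdot x x.
Proof.
rewrite -(sqr_sqrtr (qdot_ge0 x)) lerXn2r ?nnegrE ?sqrtr_ge0//.
apply: norm_quat_le => i; rewrite -sqrtr_sqr ler_wsqrtr//.
rewrite /qdot (bigD1 i)//= -expr2 lerDl sumr_ge0// => j _.
by rewrite -expr2 sqr_ge0.
Qed.

Lemma norm_qmul_le x y : `|x * y| <= 4 * `|x| * `|y| :> R.
Proof.
rewrite -(@ler_pXn2r _ 2)// ?nnegrE ?mulr_ge0//.
apply: le_trans (sqr_norm_le_qdot _) _; rewrite qdotM.
have b (z : quat R) : qdot z z <= 4 * `|z| * `|z|.
  exact: le_trans (ler_norm _) (norm_qdot_le _ _).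
apply: le_trans (ler_pM (qdot_ge0 _) (qdot_ge0 _) (b x) (b y)) _.
by rewrite -subr_ge0 [X in 0 <= X](_ : _ = 0)//; ring.
Qed.

Lemma continuous_qdot (c : quat R) : continuous (qdot c).
Proof.
apply: (@lipschitz_continuous _ _ _ _ (4 * `|c|)) => x y.
by rewrite -qdotNr -qdotDr norm_qdot_le.
Qed.

Lemma continuous_mulqr (c : quat R) : continuous (fun x : quat R => x * c).
Proof.
apply: (@lipschitz_continuous _ _ _ _ (4 * `|c|)) => x y.
by rewrite -mulrBl; apply: le_trans (norm_qmul_le _ _) _; rewrite mulrAC.
Qed.

End quaternion_coordinates.

(** * Bounded regular functions on a slice *)

Section slice_liouville.
Context {R : realType}.
Implicit Types (I c q : quat R) (z w : R * R).

Lemma is_derive_qdot {V : normedModType R} (f : V -> quat R) (z w : V) (df : quat R) c :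
  is_derive z w f df -> is_derive z w (fun x => qdot c (f x)) (qdot c df).
Proof.
move=> [/cvg_ex[l dl] <-]; rewrite /derive (cvg_lim _ dl)//.
have E h : qdot c (h^-1 *: ((f \o shift z) (h *: w) - f z)) =
    h^-1 *: (((fun x => qdot c (f x)) \o shift z) (h *: w) - qdot c (f z)).
  by rewrite qdotZr qdotDr qdotNr.
have L := continuous_cvg _ (@continuous_qdot R c l) dl.
have {}L : h^-1 *: (((fun x => qdot c (f x)) \o shift z) (h *: w) - qdot c (f z))
  @[h --> 0^'] --> qdot c l.
  by rewrite -(eq_cvg _ _ E); exact: L.
split; first by apply/cvg_ex; exists (qdot c l).
by rewrite /derive; exact/cvg_lim.
Qed.

Lemma constant_of_partials0 (u : R * R -> R) :
  (forall z, is_derive z ((1, 0) : R * R) u 0) ->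
  (forall z, is_derive z ((0, 1) : R * R) u 0) -> forall z w, u z = u w.
Proof.
move=> dx dy [x y] [x' y']; transitivity (u (x', y)).
  apply: (@is_derive_0_is_cst _ (fun x => u (x, y))) => t.
  apply: is_derive_line (dx (t, y)) => h.
  by congr (u (_, _)); rewrite /= -?[_ *: _]/(_ * _) ?mulr1// mulr0 add0r.
apply: (@is_derive_0_is_cst _ (fun y => u (x', y))) => t.
apply: is_derive_line (dy (x', t)) => h.
by congr (u (_, _)); rewrite /= -?[_ *: _]/(_ * _) ?mulr1// mulr0 add0r.
Qed.

(** Liouville's theorem on one slice. For a fixed c the real functions qdot c f and
    qdot (I c) f satisfy the Cauchy-Riemann equations, so qdot c (f_x) = 0 for every c. *)
Lemma bounded_slice_regular_constant I (f : R * R -> quat R) (K : R) :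
  imag_sphere I ->
  (forall z, derivable f z ((1, 0) : R * R) /\ derivable f z ((0, 1) : R * R)) ->
  continuous (fun z => 'D_((1, 0) : R * R) f z) ->
  continuous (fun z => 'D_((0, 1) : R * R) f z) ->
  (forall z, 'D_((1, 0) : R * R) f z + I * 'D_((0, 1) : R * R) f z = 0) ->
  (forall z, `|f z| <= K) -> forall z w, f z = f w.
Proof.
move=> hI df cfx cfy CR fK.
pose fx z := 'D_((1, 0) : R * R) f z; pose fy z := 'D_((0, 1) : R * R) f z.
(* With c the value of the derivative itself, qdot c f and qdot (I c) f are the real
   and imaginary parts of a bounded holomorphic function. *)
have fyE z : fy z = I * fx z.
  have := congr1 (fun q => I * q) (CR z).
  by rewrite mulr0 mulrDr imag_sphere_mulK// => /subr0_eq.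
have dfx z : is_derive z ((1, 0) : R * R) f (fx z).
  by apply: derivableP; case: (df z).
have dfy z : is_derive z ((0, 1) : R * R) f (fy z).
  by apply: derivableP; case: (df z).
have cq c (g : R * R -> quat R) : continuous g -> continuous (fun z => qdot c (g z)).
  by move=> cg z; apply: continuous_cvg; [exact: continuous_qdot | exact: cg].
have fx0 z : fx z = 0.
  apply/eqP; rewrite -qdot_eq0; apply/eqP.
  pose c := fx z; rewrite -/c -[in X in qdot _ X = 0]/(fx z).
  have bnd d z' : `|qdot d (f z')| <= 4 * `|d| * K.
    by apply: le_trans (norm_qdot_le _ _) _; rewrite ler_wpM2l ?mulr_ge0.
  apply: (@bounded_cauchy_riemann R (fun z => qdot c (f z))
    (fun z => qdot (I * c) (f z)) (fun z => qdot c (fx z)) (fun z => qdot c (fy z))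
    (Num.max (4 * `|c| * K) (4 * `|I * c| * K))).
  - by move=> z'; exact: is_derive_qdot.
  - by move=> z'; exact: is_derive_qdot.
  - move=> z'; apply: is_derive_eq (is_derive_qdot (I * c) (dfx z')) _.
    by rewrite fyE qdot_imagM// opprK.
  - move=> z'; apply: is_derive_eq (is_derive_qdot (I * c) (dfy z')) _.
    by rewrite fyE qdotMl; have [_ ->] := (imag_sphereP I).1 hI; rewrite mul1r.
  - exact: (cq c fx cfx).
  - exact: (cq c fy cfy).
  - by move=> z'; rewrite le_max bnd.
  - by move=> z'; rewrite le_max bnd orbT.
move=> z w; apply/eqP; rewrite -subr_eq0 -qdot_eq0; apply/eqP.
set c := f z - f w; rewrite {2}/c qdotDr qdotNr; apply/eqP; rewrite subr_eq0; apply/eqP.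
apply: (@constant_of_partials0 (fun z => qdot c (f z))) => z'.
  by have := is_derive_qdot c (dfx z'); rewrite fx0 qdot0r.
have := is_derive_qdot c (dfy z').
by rewrite fyE fx0 mulr0 qdot0r.
Qed.

End slice_liouville.

(** * Lattices, tori and their charts *)

Section lattices.
Context {R : realType}.
Implicit Types (L : lattice R) (x y q : quat R).

Lemma latticeN L x : lattice_set L x -> lattice_set L (- x).
Proof. by move=> Lx; rewrite -sub0r; apply: latticeB => //; exact: lattice0. Qed.

Lemma latticeD L x y : lattice_set L x -> lattice_set L y -> lattice_set L (x + y).
Proof. by move=> Lx Ly; rewrite -[y]opprK; apply: latticeB => //; exact: latticeN. Qed.

Lemma latticeMn L x n : lattice_set L x -> lattice_set L (x *+ n).
Proof.
move=> Lx; elim: n => [|n IH]; first by rewrite mulr0n; exact: lattice0.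
by rewrite mulrS; exact: latticeD.
Qed.

Lemma latticeMz L x (n : int) : lattice_set L x -> lattice_set L (x *~ n).
Proof.
by move=> Lx; case: n => n; [|apply: latticeN]; exact: latticeMn.
Qed.

Lemma torus_pi_eq L x y : torus_pi L x = torus_pi L y <-> lattice_set L (x - y).
Proof.
split=> [e|/asboolP e]; last exact/eqmodP.
by have /eqmodP/asboolP := e.
Qed.

Lemma torus_piK L (t : torus L) : torus_pi L (repr t) = t.
Proof. exact: reprK. Qed.

Lemma coord_lipschitz (v : 4.-tuple (quat R)) (i : 'I_4) :
  exists2 K, 0 <= K & forall x, `|coord v i x| <= K * `|x|.
Proof.
exists (\sum_j `|coord v i (delta_mx 0 j : 'rV[R]_4)|); first exact: sumr_ge0.
move=> x; rewrite {1}(row_sum_delta (x : 'rV[R]_4)) linear_sum /=.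
apply: le_trans (ler_norm_sum _ _ _) _; rewrite mulr_suml; apply: ler_sum => j _.
rewrite linearZ normrM mulrC ler_wpM2l//; exact: coord_le_norm.
Qed.

Lemma zspanE (v : 4.-tuple (quat R)) (n : 'I_4 -> int) :
  \sum_i tnth v i *~ n i = \sum_i (n i)%:~R *: v`_i.
Proof. by apply: eq_bigr => i _; rewrite scaler_int (tnth_nth 0). Qed.

(** The coordinates in a basis are bounded linear forms, and a nonzero lattice
    element has an integral coordinate of absolute value at least 1. *)
Lemma lattice_discrete L :
  exists2 e, 0 < e & forall x, lattice_set L x -> `|x| < e -> x = 0.
Proof.
have [v vfree LE] := lattice_basis L.
have /choice[K KP] i : exists K, 0 <= K /\ forall x, `|coord v i x| <= K * `|x|.
  by have [K ? ?] := coord_lipschitz v i; exists K.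
have S0 : 0 < 1 + \sum_i K i.
  by rewrite ltr_wpDr// sumr_ge0// => i _; have [] := KP i.
exists (1 + \sum_i K i)^-1; first by rewrite invr_gt0.
rewrite LE => x [n ->] xe; rewrite big1// => i _.
suff -> : n i = 0 by rewrite mulr0z.
apply/eqP; rewrite -normr_eq0 -[_ == _]negbK; apply/negP => ni0.
have : 1 <= `|coord v i (\sum_i tnth v i *~ n i)|.
  rewrite zspanE coord_sum_free// -intr_norm -[1]/(1%:~R) ler_int.
  by rewrite -gtz0_ge1 lt_def ni0 normr_ge0.
apply/negP; rewrite -ltNge.
apply: le_lt_trans ((KP i).2 _) _.
have le1 : K i <= 1 + \sum_i K i.
  rewrite (bigD1 i)//= addrCA lerDl addr_ge0// sumr_ge0// => j _.
  by have [] := KP j.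
apply: le_lt_trans (_ : (1 + \sum_i K i) * `|\sum_i tnth v i *~ n i| < 1).
  by rewrite ler_wpM2r.
by rewrite -ltr_pdivlMl// mulr1.
Qed.

(** Rounding down the coordinates moves a point by a bounded amount. *)
Lemma lattice_cocompact L :
  exists B, forall q, exists2 l, lattice_set L l & `|q - l| <= B.
Proof.
have [v vfree LE] := lattice_basis L.
have vbasis : basis_of fullv v.
  by rewrite basisEfree vfree subvf size_tuple dimvf.
exists (\sum_(i < 4) `|v`_i|) => q.
exists (\sum_i tnth v i *~ Num.floor (coord v i q)).
  by rewrite LE; exists (fun i => Num.floor (coord v i q)).
rewrite {1}(coord_basis vbasis (memvf q)) zspanE -sumrB.
apply: le_trans (ler_norm_sum _ _ _) _; apply: ler_sum => i _.
rewrite -scalerBl normrZ ler_piMl// ger0_norm ?subr_ge0 ?floor_le//.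
rewrite lerBlDl; apply/ltW.
by rewrite -[1]/(1%:~R) -intrD floorD1_gt.
Qed.

End lattices.

(** A ball is the union of the segments from its centre. *)
Lemma connected_ball {R : realType} {V : normedModType R} (x : V) (e : R) :
  connected (ball x e).
Proof.
have [e0|e0] := leP e 0.
  have -> : ball x e = set0; last exact: connected0.
  apply/seteqP; split => // y; rewrite -ball_normE /= => xy.
  by have := le_lt_trans (normr_ge0 _) xy; rewrite ltNge e0.
pose A (y : V) : set V := (fun t : R => x + t *: (y - x)) @` `[0, 1].
have -> : ball x e = \bigcup_(y in ball x e) A y.
  apply/seteqP; split => y.
    move=> xy; exists y => //; exists 1; first by rewrite /= in_itv /= ler01 lexx.
    by rewrite scale1r addrC subrK.
  rewrite -ball_normE => -[z /= xz [t]]; rewrite /= in_itv /= => /andP[t0 t1] <-.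
  rewrite opprD addrA subrr sub0r normrN normrZ ger0_norm// distrC.
  by apply: le_lt_trans xz; rewrite ler_piMl.
apply: bigcup_connected.
  exists x => y _; exists 0; first by rewrite /= in_itv /= lexx ler01.
  by rewrite scale0r addr0.
move=> y _; apply: connected_continuous_connected; first exact: segment_connected.
apply: continuous_subspaceT => t; apply: cvgD; first exact: cvg_cst.
by apply: cvgZr_tmp; exact: cvg_id.
Qed.

Section charts.
Context {R : realType}.
Implicit Types (L : lattice R) (x y q : quat R).

(** Two points of a small ball differ by less than the shortest lattice element. *)
Lemma chart_domain_ball L : exists2 e, 0 < e & forall q r, r <= e ->
  chart_domain L (ball q r).
Proof.
have [e e0 eP] := lattice_discrete L.
exists (e / 2) => [|q r re]; first by rewrite divr_gt0.
split; [exact: ball_open | exact: connected_ball |].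
move=> x y; rewrite !inE -!ball_normE /= => qx qy /torus_pi_eq Lxy.
apply/subr0_eq/(eP _ Lxy).
rewrite -(subrK q x) -addrA (le_lt_trans (ler_normD _ _))//.
by rewrite [e]splitr ltrD// ?(lt_le_trans qy)// distrC (lt_le_trans qx).
Qed.

Lemma torus_chartK L U (t : torus L) : (torus_pi L @` U) t ->
  torus_pi L (torus_chart (L := L) U t) = t.
Proof. by move=> Ut; apply: pinvK; rewrite inE. Qed.

Lemma torus_chart_in L U (t : torus L) : chart_domain L U ->
  (torus_pi L @` U) t -> U (torus_chart (L := L) U t).
Proof.
move=> [_ _ inj] Ut; have [+ _ _] := injpinv_bij (fun=> 0) inj.
exact.
Qed.

Lemma slice_regular_sub (O O' : set (quat R)) (f : quat R -> quat R) :
  open O' -> O' `<=` O -> slice_regular O f -> slice_regular O' f.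
Proof. by move=> oO' sub [_ reg]; split => // I hI fI z Oz; exact: (reg I hI z (sub _ Oz)). Qed.

(** The expression of F in charts around q0 and F (q0) is a slice regular lift of F,
    with values as close to a prescribed lift x0 of F (q0) as desired. *)
Lemma local_lift L L' (F : torus L -> torus L') q0 x0 (eps : R) :
  regular_map F -> torus_pi L' x0 = F (torus_pi L q0) -> 0 < eps ->
  exists2 f : quat R -> quat R, \forall d \near 0^'+, slice_regular (ball q0 d) f &
   \forall d \near 0^'+, forall q, ball q0 d q ->
    torus_pi L' (f q) = F (torus_pi L q) /\ `|f q - x0| < eps.
Proof.
move=> [_ reg] x0q0 eps0.
have [e e0 eP] := chart_domain_ball L; have [e' e'0 eP'] := chart_domain_ball L'.
pose V := ball x0 (Num.min eps e').
have cV : chart_domain L' V by apply: eP'; rewrite ge_min lexx orbT.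
have m0 : 0 < Num.min eps e' by rewrite lt_min eps0.
have := reg _ _ (eP q0 e (lexx e)) cV.
set O := _ `&` _; set f := _ \o _ => regf.
have Oq0 : O q0.
  split; first exact: ballxx.
  by exists x0 => //; exact: ballxx.
have [oO _] := regf.
have /nbhs_ballP[d /= d0 dO] : nbhs q0 O by exact: open_nbhs_nbhs.
have sub d' : d' <= d -> ball q0 d' `<=` O.
  by move=> d'd; apply: subset_trans dO; exact: le_ball.
exists f.
  near=> d'; apply: slice_regular_sub regf; first exact: ball_open.
  by apply: sub; near: d'; exact: nbhs_right_le.
near=> d' => q qd'.
have [_ /= Vq] : O q.
  by apply: (sub d') => //; near: d'; exact: nbhs_right_le.
split; first exact: torus_chartK.
have fV : V (f q) by exact: torus_chart_in.
rewrite distrC; apply: (@lt_le_trans _ _ (Num.min eps e')); last by rewrite ge_min lexx.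
by move: fV; rewrite /V -ball_normE.
Unshelve. all: by end_near. Qed.

End charts.

(** * Rigidity of regular maps between tori *)

Section increments.
Context {R : realType}.
Implicit Types (L : lattice R) (x y q h : quat R).

Lemma lattice_small_eq L (e : R) x y : (forall z, lattice_set L z -> `|z| < e -> z = 0) ->
  lattice_set L (x - y) -> `|x| + `|y| < e -> x = y.
Proof.
move=> eP Lxy xye; apply/subr0_eq/eP => //.
by apply: le_lt_trans xye; rewrite -(normrN y) ler_normD.
Qed.

(** Locally this is the continuity of a local lift. The constant d is uniform because
    a compact set meets every orbit of L and the increments of p are L-periodic modulo
    the lattice of the target. *)
Lemma uniform_increment L L' (F : torus L -> torus L') (p : quat R -> quat R) (eps : R) :
  regular_map F -> (forall q, torus_pi L' (p q) = F (torus_pi L q)) -> 0 < eps ->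
  exists2 d, 0 < d & forall q h, `|h| < d ->
    exists2 w, `|w| < eps & lattice_set L' (p (q + h) - p q - w).
Proof.
move=> regF pF eps0.
have [B BP] := lattice_cocompact L.
pose K : set (quat R) := [set q | `|q| <= B].
have cK : compact K.
  apply: bounded_closed_compact.
    by exists B; split; [exact: num_real | move=> M BM q /= qB; exact: le_trans (ltW BM)].
  have -> : K = closed_ball_ (fun x => `|x|) (0 : quat R) B.
    by apply/seteqP; split => q; rewrite /K /closed_ball_ /= sub0r normrN.
  exact: closed_closed_ball_.
pose P (d : R) q := forall h, `|h| < d ->
  exists2 w, `|w| < eps & lattice_set L' (p (q + h) - p q - w).
have : \forall d \near 0^'+, K `<=` P d.
  have nc := (@compact_near_coveringP _ K).1 cK.
  apply: (nc R 0^'+ P) => q0 _.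
  have [f _ fP] := local_lift regF (pF q0) (divr_gt0 eps0 (ltr0n _ 2)).
  have [d d0 dP] : exists2 d, 0 < d & forall q, ball q0 d q ->
      torus_pi L' (f q) = F (torus_pi L q) /\ `|f q - p q0| < eps / 2.
    near ((0 : R)^'+) => d; exists d; last by near: d.
    by near: d; exact: nbhs_right_gt.
  exists (ball q0 (d / 2), [set d' | d' < d / 2]) => [|[q d'] [/= qd d'd] h hd'] /=.
    split; first by apply: nbhsx_ballx; rewrite divr_gt0.
    by apply: nbhs_right_lt; rewrite divr_gt0.
  have bq : ball q0 d q by apply: le_ball qd; lra.
  have bqh : ball q0 d (q + h).
    move: qd; rewrite -!ball_normE /= opprD addrA => qd.
    apply: le_lt_trans (ler_normB _ _) _; rewrite [ltRHS]splitr ltrD//.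
    exact: lt_trans d'd.
  have [e1 n1] := dP _ bq; have [e2 n2] := dP _ bqh.
  exists (f (q + h) - f q).
    rewrite -(subrKA (p q0)) (le_lt_trans (ler_normD _ _))// [ltRHS]splitr ltrD//.
    by rewrite distrC.
  have L1 : lattice_set L' (p (q + h) - f (q + h)) by apply/torus_pi_eq; rewrite pF e2.
  have L2 : lattice_set L' (p q - f q) by apply/torus_pi_eq; rewrite pF e1.
  have := latticeB L1 L2; congr (lattice_set _ _).
  by rewrite !opprD !opprK addrACA; congr (_ + _); rewrite [LHS]addrC.
move=> near_P.
near ((0 : R)^'+) => d; exists d => [|q h hd]; first by near: d; exact: nbhs_right_gt.
have KP : K `<=` P d by near: d.
have [l Ll ql] := BP q.
have [w w1 w2] := KP _ ql h hd; exists w => //.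
have per x : lattice_set L' (p x - p (x - l)).
  apply/torus_pi_eq; rewrite !pF; congr F; apply/torus_pi_eq.
  by rewrite opprB addrC subrK.
have := latticeD (latticeB (per (q + h)) (per q)) w2.
congr (lattice_set _ _); rewrite [q + h - l]addrAC.
set a := p (q + h); set b := p (q - l + h); set c := p q; set g := p (q - l).
by apply: quatP; rewrite !qopE; ring.
Unshelve. all: by end_near. Qed.

End increments.

Section slices.
Context {R : realType}.
Implicit Types (I q : quat R) (z w : R * R).

Lemma slice_ptD I z w : slice_pt I (z + w) = slice_pt I z + slice_pt I w.
Proof. by rewrite /slice_pt /= !scalerDl addrACA. Qed.

Lemma slice_ptZ I (a : R) z : slice_pt I (a *: z) = a *: slice_pt I z.
Proof. by rewrite /slice_pt /= scalerDr !scalerA. Qed.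

Lemma slice_pt0 I : slice_pt I 0 = 0.
Proof. by rewrite /slice_pt /= !scale0r addr0. Qed.

Lemma continuous_slice_pt I : continuous (slice_pt I).
Proof.
move=> z; apply: (@cvgD _ _ _ (nbhs z) _ (fun z : R * R => z.1 *: (1 : quat R))).
  by apply: cvgZr_tmp; exact: cvg_fst.
by apply: cvgZr_tmp; exact: cvg_snd.
Qed.

Lemma is_derive_translate {V W : normedModType R} (f : V -> W) (x v c : V) df :
  is_derive (x + c) v f df -> is_derive x v (fun y => f (y + c)) df.
Proof.
have E : (fun h : R => h^-1 *: (((fun y => f (y + c)) \o shift x) (h *: v) - f (x + c))) =
         (fun h : R => h^-1 *: ((f \o shift (x + c)) (h *: v) - f (x + c))).
  by apply/funext => h /=; rewrite /shift addrA.
move=> [d <-]; split; first by rewrite /derivable E.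
by rewrite /derive E.
Qed.

(** All the local lifts of a torus map have the same derivatives, so increments
    q |-> f (q + c) - f (q) are globally defined; locally they have the form treated
    here, with g1 and g0 two local lifts and l a lattice element. *)
Lemma derive_difference {V W : normedModType R} (g0 g1 G : V -> W) (x c v : V)
    (l : W) (N : set V) :
  open N -> N x -> (forall y, N y -> G y = g1 (y + c) - g0 y - l) ->
  (forall y, N y -> derivable g0 y v /\ derivable g1 (y + c) v) ->
  {for x, continuous (fun y => 'D_v g0 y)} ->
  {for x + c, continuous (fun y => 'D_v g1 y)} ->
  [/\ derivable G x v, 'D_v G x = 'D_v g1 (x + c) - 'D_v g0 x &
      {for x, continuous (fun y => 'D_v G y)}].
Proof.
move=> oN Nx GE dg c0 c1.
have dG y : N y -> is_derive y v G ('D_v g1 (y + c) - 'D_v g0 y).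
  move=> Ny; have [dg0 dg1] := dg y Ny.
  have e1 := is_derive_translate (derivableP dg1).
  have e := is_deriveB (is_deriveB e1 (derivableP dg0)) (is_derive_cst l y v).
  rewrite subr0 in e; apply: near_eq_is_derive e.
  have nN : nbhs y N by exact: open_nbhs_nbhs.
  by apply: filterS nN => z Nz; rewrite GE.
have [dGx DGx] := dG x Nx; split => //.
have nN : nbhs x N by exact: open_nbhs_nbhs.
have E : {near x, (fun y => 'D_v G y) =1 (fun y => 'D_v g1 (y + c) - 'D_v g0 y)}.
  by apply: filterS nN => y Ny; case: (dG y Ny).
rewrite /prop_for /continuous_at DGx.
apply: (@cvg_trans _ ((fun y => 'D_v g1 (y + c) - 'D_v g0 y) @ x)).
  by apply: near_eq_cvg; apply: filterS E => y /esym.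
have cc : y + c @[y --> x] --> x + c by apply: cvgD; [exact: cvg_id | exact: cvg_cst].
exact: (cvgB (continuous_cvg _ c1 cc) c0).
Qed.

(** The difference of two slice regular functions on the same slice, one of them
    translated within the slice, is again regular there. *)
Lemma slice_difference I (f0 f1 : quat R -> quat R) (G : R * R -> quat R)
    (zeta z0 : R * R) (l : quat R) (d : R) :
  imag_sphere I -> 0 < d ->
  slice_regular (ball (slice_pt I z0) d) f0 ->
  slice_regular (ball (slice_pt I (z0 + zeta)) d) f1 ->
  (forall z, ball (slice_pt I z0) d (slice_pt I z) ->
    G z = f1 (slice_pt I (z + zeta)) - f0 (slice_pt I z) - l) ->
  [/\ derivable G z0 ((1, 0) : R * R), derivable G z0 ((0, 1) : R * R),
      {for z0, continuous (fun z => 'D_((1, 0) : R * R) G z)},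
      {for z0, continuous (fun z => 'D_((0, 1) : R * R) G z)} &
      'D_((1, 0) : R * R) G z0 + I * 'D_((0, 1) : R * R) G z0 = 0].
Proof.
move=> hI d0 [_ reg0] [_ reg1] GE.
pose g0 := f0 \o slice_pt I; pose g1 := f1 \o slice_pt I.
pose N := slice_pt I @^-1` ball (slice_pt I z0) d.
have oN : open N.
  by apply: open_comp; [move=> z _; exact: continuous_slice_pt | exact: ball_open].
have Nz0 : N z0 by exact: ballxx.
have N1 z : N z -> ball (slice_pt I (z0 + zeta)) d (slice_pt I (z + zeta)).
  have e : slice_pt I (z0 + zeta) - slice_pt I (z + zeta) = slice_pt I z0 - slice_pt I z.
    by rewrite !slice_ptD opprD addrACA subrr addr0.
  by rewrite /N /= -!ball_normE /= e.
have [_ ca1 ca2 CRa] := reg0 I hI z0 Nz0.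
have [_ cb1 cb2 CRb] := reg1 I hI (z0 + zeta) (N1 _ Nz0).
have dx z : N z -> derivable g0 z ((1, 0) : R * R) /\
    derivable g1 (z + zeta) ((1, 0) : R * R).
  move=> Nz; have [[a1 _] _ _ _] := reg0 I hI z Nz.
  have [[b1 _] _ _ _] := reg1 I hI (z + zeta) (N1 _ Nz).
  exact: (conj a1 b1).
have dy z : N z -> derivable g0 z ((0, 1) : R * R) /\
    derivable g1 (z + zeta) ((0, 1) : R * R).
  move=> Nz; have [[_ a1] _ _ _] := reg0 I hI z Nz.
  have [[_ b1] _ _ _] := reg1 I hI (z + zeta) (N1 _ Nz).
  exact: (conj a1 b1).
have [Dx ex cx] := derive_difference oN Nz0 GE dx ca1 cb1.
have [Dy ey cy] := derive_difference oN Nz0 GE dy ca2 cb2.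
split; [exact: Dx | exact: Dy | exact: cx | exact: cy |].
rewrite ex ey mulrBr addrACA -opprD.
move/eqP: CRa; rewrite scaler_eq0 invr_eq0 pnatr_eq0 /= => /eqP ->.
move/eqP: CRb; rewrite scaler_eq0 invr_eq0 pnatr_eq0 /= => /eqP ->.
by rewrite subr0.
Qed.

End slices.

Section affine.
Context {R : realType}.
Implicit Types (L : lattice R) (q h I : quat R).

Lemma slice_decomposition q : exists I z, imag_sphere I /\ q = slice_pt I z.
Proof.
pose v := q - (qre q)%:A.
have v0 : qre v = 0 by rewrite /v !qopE; ring.
have qE : q = (qre q)%:A + v by rewrite /v addrC subrK.
have [e|ne] := eqVneq v 0.
  exists (Quat 0 1 0 0), (qre q, 0); split.
    by apply/imag_sphereP; rewrite qdotE !qopE; split => //; ring.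
  by rewrite /slice_pt /= scale0r {1}qE e.
exists ((qnorm v)^-1 *: v), (qre q, qnorm v); split; last first.
  rewrite /slice_pt /= scalerA divff ?scale1r//.
  by rewrite /qnorm sqrtr_eq0 -ltNge qdot_gt0.
apply/imag_sphereP; rewrite qreZ v0 mulr0; split => //.
rewrite qdotZl qdotZr mulrA -invfM -expr2 sqr_sqrtr ?qdot_ge0//.
by rewrite mulVf// gt_eqF// qdot_gt0.
Qed.

(** phi (t) = n phi (t / n) compares phi (t) with the derivative at 0. *)
Lemma locally_additive_linear {V : normedModType R} (phi : R -> V) (eta : R) (D : V) :
  0 < eta ->
  (forall s t, `|s| < eta -> `|t| < eta -> `|s + t| < eta ->
     phi (s + t) = phi s + phi t) ->
  h^-1 *: phi h @[h --> 0^'] --> D ->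
  forall t, `|t| < eta -> phi t = t *: D.
Proof.
move=> eta0 add cvgD t teta.
have phi0 : phi 0 = 0.
  have := add 0 0; rewrite addr0 normr0 => /(_ eta0 eta0 eta0) /eqP.
  by rewrite addrC -subr_eq subrr => /eqP/esym.
have [->|t0] := eqVneq t 0; first by rewrite phi0 scale0r.
have phin n k : (k <= n.+1)%N -> phi (k%:R * (t / n.+1%:R)) = k%:R *: phi (t / n.+1%:R).
  have small k' : (k' <= n.+1)%N -> `|k'%:R * (t / n.+1%:R)| < eta.
    move=> kn; apply: le_lt_trans teta; rewrite mulrCA normrM ler_piMr//.
    by rewrite ger0_norm ?divr_ge0// ler_pdivrMr ?ltr0n// mul1r ler_nat.
  elim: k => [|k IH] kn; first by rewrite mul0r phi0 scale0r.
  rewrite -natr1 mulrDl mul1r scalerDl scale1r -IH ?(ltnW kn)//; apply: add.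
  - exact/small/ltnW.
  - by have := small 1%N isT; rewrite mul1r.
  - by rewrite -[X in _ + X]mul1r -mulrDl natr1; exact: small.
suff -> : D = t^-1 *: phi t by rewrite scalerA divff ?scale1r.
apply/subr0_eq/eqP; rewrite -normr_le0; apply/ler_addgt0Pl => e e0; rewrite addr0.
have /cvgrPdist_le/(_ _ e0)/nbhs_ballP[r /= r0 rP] := cvgD.
have [n nr] : exists n, `|t / n.+1%:R| < r.
  exists (Num.truncn (`|t| / r)).
  rewrite normrM normfV normr_nat ltr_pdivrMr ?ltr0n// -ltr_pdivrMl//.
  by rewrite mulrC; exact: real_truncnS_gt (num_real _).
have un0 : t / n.+1%:R != 0 by rewrite mulf_neq0 ?invr_eq0 ?pnatr_eq0.
have := rP (t / n.+1%:R); rewrite -ball_normE /= sub0r normrN => /(_ nr un0).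
have -> : (t / n.+1%:R)^-1 *: phi (t / n.+1%:R) = t^-1 *: phi t; last by [].
have := phin n _ (leqnn _); rewrite mulrC divfK ?pnatr_eq0// => ->.
by rewrite scalerA invfM invrK.
Qed.

Lemma scaled_small {V : normedModType R} (v : V) (d : R) : 0 < d ->
  exists2 eta, 0 < eta & forall t, `|t| < eta -> `|t *: v| < d.
Proof.
move=> d0; have v1 : 0 < `|v| + 1 by rewrite ltr_wpDl.
exists (d / (`|v| + 1)) => [|t]; first by rewrite divr_gt0.
rewrite ltr_pdivlMr// normrZ; apply: le_lt_trans; by rewrite ler_wpM2l// lerDl.
Qed.

Lemma subdivision_small {V : normedModType R} (v : V) (d : R) : 0 < d ->
  exists n0 : nat, forall n, (n0 <= n)%N -> `|n.+1%:R^-1 *: v| < d.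
Proof.
move=> d0; exists (Num.truncn (`|v| / d)) => n n0n.
rewrite normrZ normfV normr_nat mulrC ltr_pdivrMr ?ltr0n// -ltr_pdivrMl// mulrC.
by apply: lt_le_trans (real_truncnS_gt (num_real _)) _; rewrite ler_nat ltnS.
Qed.

End affine.

Section rigidity.
Context {R : realType}.
Implicit Types (L : lattice R) (q h I : quat R).

Lemma slice_pt_real I (t : R) : slice_pt I (t, 0) = t *: 1.
Proof. by rewrite /slice_pt /= scale0r addr0. Qed.

Lemma slice_pt_imag I (t : R) : slice_pt I (0, t) = t *: I.
Proof. by rewrite /slice_pt /= scale0r add0r. Qed.

(** The heart of the rigidity argument. For a small h let g (q, h) be the
    smallest representative of p (q + h) - p (q) modulo the lattice. It is unique and defined
    for all q, bounded, and slice regular in q on the slice of h. By the theorem of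
    Liouville it does not depend on q within that slice, and D (h) is its value. *)
Lemma slice_increments L L' (F : torus L -> torus L') (p : quat R -> quat R) (e eps : R) :
  regular_map F -> (forall q, torus_pi L' (p q) = F (torus_pi L q)) ->
  (forall x, lattice_set L' x -> `|x| < e -> x = 0) -> 0 < eps -> 8 * eps <= e ->
  exists2 d, 0 < d & exists D : quat R -> quat R,
    [/\ forall h, `|h| < d -> `|D h| < eps,
        forall I z w, imag_sphere I -> `|slice_pt I w| < d ->
          lattice_set L' (p (slice_pt I z + slice_pt I w) - p (slice_pt I z) -
                          D (slice_pt I w)) &
        forall I z w, imag_sphere I -> `|slice_pt I z| < d -> `|slice_pt I w| < d ->
          `|slice_pt I z + slice_pt I w| < d ->
          D (slice_pt I z + slice_pt I w) = D (slice_pt I z) + D (slice_pt I w)].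
Proof.
move=> regF pF eP eps0 eps_e.
have [d d0 dP] := uniform_increment regF pF eps0.
have /choice[g gP] (qh : quat R * quat R) : exists w, `|qh.2| < d ->
    `|w| < eps /\ lattice_set L' (p (qh.1 + qh.2) - p qh.1 - w).
  have [hd|hd] := ltP `|qh.2| d; last by exists 0.
  by have [w ? ?] := dP qh.1 _ hd; exists w.
have g_small q h : `|h| < d -> `|g (q, h)| < eps by move=> hd; case: (gP (q, h) hd).
have g_lattice q h : `|h| < d -> lattice_set L' (p (q + h) - p q - g (q, h)).
  by move=> hd; case: (gP (q, h) hd).
have gD q h k : `|h| < d -> `|k| < d -> `|h + k| < d ->
    g (q, h + k) = g (q, h) + g (q + h, k).
  move=> hd kd hkd; apply: (lattice_small_eq eP).
    have := latticeB (latticeD (g_lattice q _ hd) (g_lattice (q + h) _ kd)) (g_lattice q _ hkd).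
    congr (lattice_set _ _); rewrite [q + (h + k)]addrA.
    set a := p (q + h + k); set b := p (q + h); set c := p q.
    by apply: quatP; rewrite !qopE; ring.
  have := g_small q _ hkd; have := g_small q _ hd; have := g_small (q + h) _ kd.
  have := ler_normD (g (q, h)) (g (q + h, k)); lra.
have lift q0 := local_lift regF (pF q0) eps0.
have g_const I zeta : imag_sphere I -> `|slice_pt I zeta| < d -> forall z,
    g (slice_pt I z, slice_pt I zeta) = g (0, slice_pt I zeta).
  move=> hI zd z; pose G (z : R * R) := g (slice_pt I z, slice_pt I zeta).
  rewrite -(slice_pt0 I) -/(G z) -/(G 0).
  have loc z0 : [/\ derivable G z0 ((1, 0) : R * R), derivable G z0 ((0, 1) : R * R),
      {for z0, continuous (fun z => 'D_((1, 0) : R * R) G z)},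
      {for z0, continuous (fun z => 'D_((0, 1) : R * R) G z)} &
      'D_((1, 0) : R * R) G z0 + I * 'D_((0, 1) : R * R) G z0 = 0].
    have [f0 reg0 lift0] := lift (slice_pt I z0).
    have [f1 reg1 lift1] := lift (slice_pt I (z0 + zeta)).
    have [r [r0 regf0 regf1 lf0 lf1]] : exists r, [/\ 0 < r,
        slice_regular (ball (slice_pt I z0) r) f0,
        slice_regular (ball (slice_pt I (z0 + zeta)) r) f1,
        forall q, ball (slice_pt I z0) r q ->
          torus_pi L' (f0 q) = F (torus_pi L q) /\ `|f0 q - p (slice_pt I z0)| < eps &
        forall q, ball (slice_pt I (z0 + zeta)) r q ->
          torus_pi L' (f1 q) = F (torus_pi L q) /\
          `|f1 q - p (slice_pt I (z0 + zeta))| < eps].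
      near ((0 : R)^'+) => r; exists r; split; near: r;
        [exact: nbhs_right_gt | exact: reg0 | exact: reg1 | exact: lift0 | exact: lift1].
    set q0 := slice_pt I z0 in lf0; set q1 := slice_pt I (z0 + zeta) in lf1.
    have q1E : q1 = q0 + slice_pt I zeta by rewrite /q1 slice_ptD.
    (* The lattice element l makes the difference of the two lifts agree with g at
       q0, hence nearby, both being too small to differ by a nonzero lattice element. *)
    pose l := f1 q1 - f0 q0 - g (q0, slice_pt I zeta).
    have lf0_lattice q : ball q0 r q -> lattice_set L' (f0 q - p q).
      by move=> /lf0[e1 _]; apply/torus_pi_eq; rewrite e1 pF.
    have lf1_lattice q : ball q1 r q -> lattice_set L' (f1 q - p q).
      by move=> /lf1[e1 _]; apply/torus_pi_eq; rewrite e1 pF.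
    have b0 : ball q0 r q0 by exact: ballxx.
    have b1 : ball q1 r q1 by exact: ballxx.
    apply: (slice_difference (f0 := f0) (f1 := f1) (zeta := zeta) (l := l) hI r0 regf0 regf1).
    move=> z' bz'; rewrite /G.
    set q := slice_pt I z' in bz' *.
    have qE : slice_pt I (z' + zeta) = q + slice_pt I zeta by rewrite slice_ptD.
    have bq : ball q1 r (q + slice_pt I zeta).
      have e1 : q0 + slice_pt I zeta - (q + slice_pt I zeta) = q0 - q.
        by rewrite opprD addrACA subrr addr0.
      by move: bz'; rewrite q1E -!ball_normE /= e1.
    rewrite qE; apply: (lattice_small_eq eP).
      have A := latticeB (lf1_lattice _ bq) (lf0_lattice _ bz').
      have B := latticeB (lf1_lattice _ b1) (lf0_lattice _ b0).
      have C := latticeB (g_lattice q _ zd) (g_lattice q0 _ zd).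
      have := latticeN (latticeD (latticeB A B) C).
      congr (lattice_set _ _); rewrite /l -q1E.
      set x1 := f1 (q + _); set x2 := f0 q; set x3 := p q; set x4 := p (q + _).
      set x5 := p q1; set x6 := p q0; set x7 := f1 q1; set x8 := f0 q0.
      by apply: quatP; rewrite !qopE; ring.
    have [_ n1] := lf0 _ bz'; have [_ n2] := lf0 _ b0.
    have [_ n3] := lf1 _ bq; have [_ n4] := lf1 _ b1.
    have n5 := g_small q _ zd; have n6 := g_small q0 _ zd.
    have : `|f1 (q + slice_pt I zeta) - f0 q - l| <=
        `|f1 (q + slice_pt I zeta) - p q1| + `|f1 q1 - p q1| +
        (`|f0 q - p q0| + `|f0 q0 - p q0|) + `|g (q0, slice_pt I zeta)|.
      have -> : f1 (q + slice_pt I zeta) - f0 q - l =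
          (f1 (q + slice_pt I zeta) - p q1) - (f1 q1 - p q1) -
          ((f0 q - p q0) - (f0 q0 - p q0)) + g (q0, slice_pt I zeta).
        rewrite /l; set x1 := f1 (q + _); set x2 := f0 q; set x3 := f1 q1.
        set x4 := f0 q0; set x5 := p q1; set x6 := p q0.
        by apply: quatP; rewrite !qopE; ring.
      apply: le_trans (ler_normD _ _) _; rewrite lerD2r.
      by apply: le_trans (ler_normB _ _) _; apply: lerD; exact: ler_normB.
    by lra.
  apply: (@bounded_slice_regular_constant R I G eps hI).
  - by move=> z'; case: (loc z') => a1 a2 _ _ _; exact: (conj a1 a2).
  - by move=> z'; case: (loc z') => _ _ a1 _ _; exact: a1.
  - by move=> z'; case: (loc z') => _ _ _ a1 _; exact: a1.
  - by move=> z'; case: (loc z') => _ _ _ _ a1; exact: a1.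
  - by move=> z'; apply/ltW/g_small.
exists d => //; exists (fun h => g (0, h)); split.
- by move=> h; exact: g_small.
- by move=> I z w hI wd; rewrite -(g_const I w hI wd z); exact: g_lattice.
- move=> I z w hI zd wd zwd; rewrite gD// add0r.
  by congr (_ + _); exact: g_const.
Unshelve. all: by end_near. Qed.

(** D is additive on small elements of each slice and regular at 0, hence equal to
    right multiplication by its derivative a at 0; this a is the same on all slices since
    they share the real axis. Adding up small steps from 0 to q gives F. *)
Lemma regular_torus_map_affine L L' (F : torus L -> torus L') : regular_map F ->
  exists a b, forall q, F (torus_pi L q) = torus_pi L' (q * a + b).
Proof.
move=> regF; pose p q := repr (F (torus_pi L q)).
have pF q : torus_pi L' (p q) = F (torus_pi L q) by exact: torus_piK.
have [e e0 eP] := lattice_discrete L'.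
(* Small enough for sums of the six increments compared below to stay under e. *)
pose eps := e / 8; have eps0 : 0 < eps by rewrite divr_gt0.
have eps_e : 8 * eps <= e by rewrite /eps; lra.
have [d d0 [D [D_small D_lattice D_add]]] := slice_increments regF pF eP eps0 eps_e.
have [f regf liftf] := local_lift regF (pF 0) eps0.
have [r [r0 regfr lf]] : exists r, [/\ 0 < r, slice_regular (ball 0 r) f &
    forall q, ball 0 r q -> torus_pi L' (f q) = F (torus_pi L q) /\ `|f q - p 0| < eps].
  near ((0 : R)^'+) => r; exists r; split; near: r;
    [exact: nbhs_right_gt | exact: regf | exact: liftf].
have DE I w : imag_sphere I -> `|slice_pt I w| < d -> `|slice_pt I w| < r ->
    D (slice_pt I w) = f (slice_pt I w) - f 0.
  move=> hI wd wr; have b0 : ball 0 r (0 : quat R) by exact: ballxx.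
  have bw : ball 0 r (slice_pt I w) by rewrite -ball_normE /= sub0r normrN.
  have [e1 n1] := lf _ bw; have [e2 n2] := lf _ b0.
  have l1 : lattice_set L' (f (slice_pt I w) - p (slice_pt I w)).
    by apply/torus_pi_eq; rewrite e1 pF.
  have l2 : lattice_set L' (f 0 - p 0) by apply/torus_pi_eq; rewrite e2 pF.
  apply: (lattice_small_eq eP).
    have := D_lattice I 0 w hI wd; rewrite slice_pt0 add0r => l3.
    have := latticeB (latticeB l2 l1) l3; congr (lattice_set _ _).
    set x1 := p (slice_pt I w); set x2 := p 0; set x3 := D _; set x4 := f _; set x5 := f 0.
    by apply: quatP; rewrite !qopE; ring.
  have n3 := D_small _ wd.
  have : `|f (slice_pt I w) - f 0| <= `|f (slice_pt I w) - p 0| + `|f 0 - p 0|.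
    apply: le_trans (ler_normB _ _); rewrite le_eqVlt; apply/orP; left.
    apply/eqP; congr (`|_|); set x1 := f _; set x2 := f 0; set x3 := p 0.
    by apply: quatP; rewrite !qopE; ring.
  by rewrite /eps in n1 n2 n3; lra.
(* On a real line of a slice, D is additive and has a derivative at 0. *)
have D_lin I v (w : R * R) (df : quat R) : imag_sphere I ->
    (forall t, slice_pt I (t *: w) = t *: v) ->
    is_derive (0 : R * R) w (f \o slice_pt I) df ->
    exists2 eta, 0 < eta & forall t, `|t| < eta -> D (t *: v) = t *: df.
  move=> hI wv [/cvg_ex[l dl] fdf].
  have {}fdf : l = df by rewrite -fdf /derive (cvg_lim _ dl).
  have [eta1 eta10 eta1P] := scaled_small v d0.
  have [eta2 eta20 eta2P] := scaled_small v r0.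
  exists eta1 => //; apply: (@locally_additive_linear R _ (fun t => D (t *: v)) eta1 df) => //.
    move=> s t' /eta1P sd /eta1P td /eta1P std; rewrite scalerDl in std *.
    by rewrite -!wv in sd td std *; exact: D_add.
  move: dl; rewrite fdf; apply: cvg_trans; apply: near_eq_cvg; near=> h => /=.
  have h1 : `|h| < eta1 by near: h; exact: dnbhs0_lt.
  have h2 : `|h| < eta2 by near: h; exact: dnbhs0_lt.
  have := eta1P _ h1; have := eta2P _ h2; rewrite /shift addr0 slice_pt0 -wv => ? ?.
  by rewrite DE.
have reg0 I : imag_sphere I -> let fI := f \o slice_pt I in
    [/\ derivable fI 0 ((1, 0) : R * R), derivable fI 0 ((0, 1) : R * R) &
    'D_((1, 0) : R * R) fI 0 + I * 'D_((0, 1) : R * R) fI 0 = 0].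
  move=> hI fI; have [_ /(_ I hI 0)] := regfr; rewrite slice_pt0 => /(_ (ballxx _ r0)).
  move=> [[a1 a2] _ _ CR]; split; [exact: a1 | exact: a2 |].
  by move/eqP: CR; rewrite scaler_eq0 invr_eq0 pnatr_eq0 /= => /eqP.
have scal I t : slice_pt I (t *: ((1, 0) : R * R)) = t *: 1.
  by rewrite slice_ptZ slice_pt_real scale1r.
have scali I t : slice_pt I (t *: ((0, 1) : R * R)) = t *: I.
  by rewrite slice_ptZ slice_pt_imag scale1r.
(* The derivative along the reals is the same for every slice, so that a single a
   serves for all of them. *)
have [a aP] : exists a, exists2 eta, 0 < eta & forall t, `|t| < eta -> D (t *: 1) = t *: a.
  have hI : imag_sphere (Quat 0 1 0 0 : quat R).
    by apply/imag_sphereP; rewrite qdotE !qopE; split => //; ring.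
  have [dx _ _] := reg0 _ hI.
  have := D_lin _ _ _ _ hI (scal _) (derivableP dx).
  by exists ('D_((1, 0) : R * R) (f \o slice_pt (Quat 0 1 0 0)) (0 : R * R)).
have D_slice I : imag_sphere I -> exists2 eta, 0 < eta & forall x y,
    `|x| < eta -> `|y| < eta -> D (slice_pt I (x, y)) = slice_pt I (x, y) * a.
  move=> hI; have [dx dy CR] := reg0 I hI.
  have [eta1 eta10 eta1P] := D_lin _ _ _ _ hI (scal _) (derivableP dx).
  have [eta2 eta20 eta2P] := D_lin _ _ _ _ hI (scali _) (derivableP dy).
  have [eta3 eta30 eta3P] := aP.
  have [eta4 eta40 eta4P] := scaled_small (1 : quat R) (divr_gt0 d0 (ltr0n _ 2)).
  have [eta5 eta50 eta5P] := scaled_small I (divr_gt0 d0 (ltr0n _ 2)).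
  pose ax := 'D_((1, 0) : R * R) (f \o slice_pt I) (0 : R * R).
  pose ay := 'D_((0, 1) : R * R) (f \o slice_pt I) (0 : R * R).
  rewrite -/ax in eta1P CR; rewrite -/ay in eta2P CR.
  have axE : ax = a.
    near ((0 : R)^'+) => t; have t0 : 0 < t by near: t; exact: nbhs_right_gt.
    have t1 : `|t| < eta1 by rewrite gtr0_norm//; near: t; exact: nbhs_right_lt.
    have t3 : `|t| < eta3 by rewrite gtr0_norm//; near: t; exact: nbhs_right_lt.
    have := eta1P _ t1; rewrite eta3P// => /(congr1 (fun q => t^-1 *: q)).
    by rewrite !scalerA mulVf ?gt_eqF// !scale1r.
  have ayE : ay = I * a.
    have := congr1 (fun q => I * q) CR; rewrite mulr0 mulrDr imag_sphere_mulK// axE.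
    by move=> /subr0_eq.
  near ((0 : R)^'+) => eta; exists eta => [|x y xe ye]; first by near: eta; exact: nbhs_right_gt.
  have le_eta s t : eta <= s -> `|t| < eta -> `|t| < s by move=> h1 h2; exact: lt_le_trans h1.
  have x2 : `|x| < eta1 by apply: le_eta xe; near: eta; exact: nbhs_right_le.
  have y2 : `|y| < eta2 by apply: le_eta ye; near: eta; exact: nbhs_right_le.
  have x4 : `|x *: 1 : quat R| < d / 2.
    by apply: eta4P; apply: le_eta xe; near: eta; exact: nbhs_right_le.
  have y5 : `|y *: I| < d / 2.
    by apply: eta5P; apply: le_eta ye; near: eta; exact: nbhs_right_le.
  have e1 : slice_pt I (x, 0) = x *: 1 by exact: slice_pt_real.
  have e2 : slice_pt I (0, y) = y *: I by exact: slice_pt_imag.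
  have e3 : slice_pt I (x, y) = slice_pt I (x, 0) + slice_pt I (0, y) by rewrite e1 e2.
  have d2 : d / 2 < d by rewrite ltr_pdivrMr// ltr_pMr// ltr1n.
  have s4 : `|x *: 1 : quat R| < d by exact: lt_trans x4 d2.
  have s5 : `|y *: I| < d by exact: lt_trans y5 d2.
  rewrite e3 D_add ?e1 ?e2//; last first.
    by rewrite (le_lt_trans (ler_normD _ _))// [d]splitr ltrD.
  by rewrite eta1P// eta2P// axE ayE mulrDl -!scalerAl mul1r.
exists a, (p 0) => q; rewrite -pF; apply/torus_pi_eq.
have [I [[x y] [hI qE]]] := slice_decomposition q.
have [eta eta0 etaP] := D_slice I hI.
have [n1 n1P] := subdivision_small (x : R^o) eta0.
have [n2 n2P] := subdivision_small (y : R^o) eta0.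
have [n3 n3P] := subdivision_small q d0.
pose n := (n1 + n2 + n3)%N; pose N : R := n.+1%:R.
pose w : R * R := (N^-1 * x, N^-1 * y).
have hE : slice_pt I w = N^-1 *: q.
  by rewrite qE -slice_ptZ.
have hd : `|slice_pt I w| < d by rewrite hE; apply: n3P; rewrite /n leq_addl.
have Dw : D (slice_pt I w) = (N^-1 *: q) * a.
  rewrite -hE; apply: etaP; first by apply: n1P; rewrite /n -addnA leq_addr.
  by apply: n2P; rewrite /n addnAC leq_addl.
(* The segment from 0 to q is covered by n + 1 steps w, all inside one slice. *)
have walk k : lattice_set L' (p ((k%:R / N) *: q) - (((k%:R / N) *: q) * a + p 0)).
  elim: k => [|k IH].
    by rewrite mul0r scale0r mul0r add0r subrr; exact: lattice0.
  have := D_lattice I ((k%:R / N) *: (x, y)) w hI hd.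
  rewrite slice_ptZ -qE hE -hE Dw hE -scalerDl.
  have -> : k%:R / N + N^-1 = k.+1%:R / N by rewrite -natr1 mulrDl mul1r.
  move=> /(latticeD IH); congr (lattice_set _ _).
  have -> : (k.+1%:R / N) *: q * a = (k%:R / N) *: q * a + N^-1 *: q * a.
    by rewrite -mulrDl -scalerDl -natr1 [in LHS]mulrDl mul1r.
  set x1 := p _; set x2 := _ * a; set x3 := _ * a; set x4 := p 0; set x5 := p _.
  by apply: quatP; rewrite !qopE; ring.
by have := walk n.+1; rewrite divff ?pnatr_eq0// scale1r.
Unshelve. all: by end_near. Qed.

End rigidity.

(** * Equivalence of tori and scaling of lattices *)

Section equivalence.
Context {R : realType}.
Implicit Types (L : lattice R) (q c I : quat R).

(** The difference quotients of a linear map are constant. *)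
Lemma is_derive_linear {V W : normedModType R} (f : V -> W) (l : W) (x v : V) :
  (forall t y z, f (t *: y + z) = t *: f y + f z) ->
  is_derive x v (fun y => f y - l) (f v).
Proof.
move=> fD.
have key : h^-1 *: (((fun y => f y - l) \o shift x) (h *: v) - (f x - l))
    @[h --> (0 : R)^'] --> f v.
  apply: (@cvg_trans _ ((fun _ : R => f v) @ 0^')); last exact: cvg_cst.
  apply: near_eq_cvg; near=> h => /=.
  have h0 : h != 0 by near: h; exact: nbhs_dnbhs_neq.
  by rewrite /shift fD opprB addrA subrK addrK scalerA mulVf// scale1r.
split; first by apply/cvg_ex; exists (f v).
by rewrite /derive; exact/cvg_lim.
Unshelve. all: by end_near. Qed.

Lemma near_constant_continuous {V W : topologicalType} (f : V -> W) (w : W) (x : V) :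
  (\forall y \near x, f y = w) -> {for x, continuous f}.
Proof.
move=> fw; rewrite /prop_for /continuous_at (nbhs_singleton fw).
apply: (@cvg_trans _ ((fun _ : V => w) @ x)); last exact: cvg_cst.
by apply: near_eq_cvg; apply: filterS fw => y /esym.
Qed.

(** In charts the map is q |-> q c - l with l locally constant in the target lattice,
    and right multiplications are slice regular. *)
Lemma regular_right_mul L L' c (F : torus L -> torus L') :
  (forall q, F (torus_pi L q) = torus_pi L' (q * c)) -> regular_map F.
Proof.
move=> FE.
have ctsF : continuous F.
  apply/quotient_continuous.
  have -> : F \o \pi_(torus L)%qT = torus_pi L' \o (fun q => q * c).
    by apply/funext => q; exact: FE.
  move=> q; apply: continuous_comp; first exact: continuous_mulqr.
  exact: pi_continuous.
split; first exact: ctsF.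
move=> U V [oU _ injU] [oV _ injV].
set O := _ `&` _; set f := _ \o _.
have contV l : continuous (fun q : quat R => q * c - l).
  apply: (@lipschitz_continuous _ _ _ _ (4 * `|c|)) => x y.
  rewrite opprB addrA subrK -mulrBl; apply: le_trans (norm_qmul_le _ _) _.
  by rewrite mulrAC.
have loc q0 : O q0 -> exists2 l, nbhs q0 (O `&` [set q | f q = q * c - l]) & True.
  move=> [Uq0 [v Vv vq0]].
  have Ll : lattice_set L' (q0 * c - v).
    by apply/torus_pi_eq; rewrite -FE; exact/esym.
  exists (q0 * c - v) => //; set l := q0 * c - v.
  have nV : nbhs q0 [set q | V (q * c - l)].
    apply: (contV l); apply: open_nbhs_nbhs; split => //.
    by rewrite /= /l subKr.
  have nU : nbhs q0 U by exact: open_nbhs_nbhs.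
  apply: filterS (filterI nU nV) => q [Uq Vq].
  have piq : torus_pi L' (q * c - l) = F (torus_pi L q).
    rewrite FE; apply/torus_pi_eq.
    by rewrite addrAC subrr sub0r; exact: latticeN.
  split; first by split => //; exists (q * c - l).
  by rewrite /f /= -piq; apply: pinvKV; rewrite ?inE.
have oO : open O.
  rewrite openE => q0 /loc[l nl _]; rewrite /interior.
  by apply: filterS nl => q [].
split; first exact: oO.
move=> I hI fI z Oz.
have [l nl _] := loc _ Oz.
have nz : \forall w \near z, fI w = slice_pt I w * c - l.
  have nl' : nbhs z (slice_pt I @^-1` (O `&` [set q | f q = q * c - l])).
    exact: continuous_slice_pt nl.
  by apply: filterS nl' => w [_ fw]; exact: fw.
have nnz : \forall w \near z, \forall w' \near w, fI w' = slice_pt I w' * c - l.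
  exact: near_join nz.
have D w v : (\forall w' \near w, fI w' = slice_pt I w' * c - l) ->
    is_derive w v fI (slice_pt I v * c).
  move=> nw; apply: (near_eq_is_derive (f := fun w => slice_pt I w * c - l)).
    by apply: filterS nw => w' ->.
  apply: (@is_derive_linear _ _ (fun w => slice_pt I w * c)) => t y y'.
  by rewrite slice_ptD slice_ptZ mulrDl scalerAl.
have cD v : {for z, continuous (fun w => 'D_v fI w)}.
  apply: (@near_constant_continuous _ _ _ (slice_pt I v * c)).
  by apply: filterS nnz => w nw; have [_ ->] := D w v nw.
have [d1 e1] := D z (1, 0) nz; have [d2 e2] := D z (0, 1) nz.
split; [exact: (conj d1 d2) | exact: (cD (1, 0)) | exact: (cD (0, 1)) |].
rewrite e1 e2 /slice_pt /= !scale0r !scale1r addr0 add0r mul1r.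
by rewrite imag_sphere_mulK// subrr scaler0.
Qed.

Lemma right_scaling_equivalent L L' c : c != 0 ->
  (forall x, lattice_set L x <-> lattice_set L' (x * c)) -> torus_equivalent L L'.
Proof.
move=> c0 LE.
pose F (t : torus L) := torus_pi L' (repr t * c).
pose G (t : torus L') := torus_pi L (repr t * c^-1).
have cV : c * c^-1 = 1 by exact: qmulqV.
have Vc : c^-1 * c = 1 by exact: qmulVq.
have FE q : F (torus_pi L q) = torus_pi L' (q * c).
  by apply/torus_pi_eq; rewrite -mulrBl; apply/LE/torus_pi_eq; exact: torus_piK.
have GE q : G (torus_pi L' q) = torus_pi L (q * c^-1).
  apply/torus_pi_eq; rewrite -mulrBl; apply/LE; rewrite -mulrA Vc mulr1.
  by apply/torus_pi_eq; exact: torus_piK.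
exists F, G; split.
- by move=> t; rewrite -[t in RHS]torus_piK /F GE -mulrA cV mulr1.
- by move=> t; rewrite -[t in RHS]torus_piK /G FE -mulrA Vc mulr1.
- exact: regular_right_mul FE.
- exact: regular_right_mul GE.
Qed.

(** Both F and its inverse are induced by affine maps q |-> q a + b and
    q |-> q a' + b'. Discreteness of L forces a a' = 1, so that L a is the whole target
    lattice. *)
Lemma equivalent_right_scaling L L' : torus_equivalent L L' ->
  exists2 c, c != 0 & forall x, lattice_set L x <-> lattice_set L' (x * c).
Proof.
move=> [F [G [FK GK regF regG]]].
have [a [b FE]] := regular_torus_map_affine regF.
have [a' [b' GE]] := regular_torus_map_affine regG.
have [e e0 eP] := lattice_discrete L.
(* q (a a' - 1) lies in L for every q, in particular for arbitrarily small ones. *)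
have aa' : a * a' = 1.
  apply/subr0_eq; set u := a * a' - 1.
  have Lu q : lattice_set L (q * u).
    have per x : lattice_set L ((x * a + b) * a' + b' - x).
      by apply/torus_pi_eq; rewrite -GE -FE FK.
    have := latticeB (per q) (per 0); congr (lattice_set _ _).
    rewrite /u mulrBr mulr1 mul0r add0r subr0 mulrDl mulrA.
    set x1 := q * a * a'; set x2 := b * a'.
    by apply: quatP; rewrite !qopE; ring.
  have [eta eta0 etaP] := scaled_small u e0.
  have small : `|eta / 2| < eta.
    by rewrite gtr0_norm ?divr_gt0// ltr_pdivrMr// ltr_pMr// ltr1n.
  have := eP ((eta / 2) *: u); rewrite -[in X in X -> _](mul1r u) scalerAl.
  move=> /(_ (Lu _)); rewrite -scalerAl mul1r => /(_ (etaP _ small))/eqP.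
  by rewrite scaler_eq0 mulf_eq0 invr_eq0 pnatr_eq0 gt_eqF//= => /eqP.
have a0 : a != 0 by apply/eqP => a0; move: aa'; rewrite a0 mul0r => /esym/eqP; rewrite oner_eq0.
exists a => // x; split=> Lx.
  have := FE x; have -> : torus_pi L x = torus_pi L 0 by apply/torus_pi_eq; rewrite subr0.
  rewrite FE mul0r add0r => /esym/torus_pi_eq.
  by rewrite addrK.
have := GE (x * a); have -> : torus_pi L' (x * a) = torus_pi L' 0.
  by apply/torus_pi_eq; rewrite subr0.
rewrite GE mul0r add0r => /esym/torus_pi_eq.
by rewrite addrK -mulrA aa' mulr1.
Qed.

End equivalence.

(** * Orthogonal frames *)

Section frames.
Context {R : realType}.
Implicit Types (I J x y q : quat R).

Lemma imag_anticomm I J : imag_sphere I -> imag_sphere J ->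
  qdot I J = 0 <-> J * I = - (I * J).
Proof.
move=> /imag_sphereP[I0 _] /imag_sphereP[J0 _].
have E : J * I + I * J = (- (2 * qdot I J)) *: 1.
  by apply: quatP; rewrite !qdotE !qopE I0 J0; ring.
split=> [d0|/eqP]; first by apply/eqP; rewrite -addr_eq0 E d0 mulr0 oppr0 scale0r.
rewrite -addr_eq0 E scaler_eq0 oner_eq0 orbF oppr_eq0 mulf_eq0 pnatr_eq0 /=.
by move=> /eqP.
Qed.

(** Meant for orthogonal imaginary units I and J, which make 1, I, J, IJ an orthonormal
    basis; frame_coord is then the inverse map. *)
Definition frame I J x : quat R :=
  qre x *: 1 + qi x *: I + qj x *: J + qk x *: (I * J).

Definition frame_coord I J q : quat R :=
  Quat (qdot q 1) (qdot q I) (qdot q J) (qdot q (I * J)).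

Section orthogonal_pair.
Variables (I J : quat R).
Hypotheses (hI : imag_sphere I) (hJ : imag_sphere J) (hIJ : qdot I J = 0).

Lemma frame_table : [/\ I * I = -1, J * J = -1 & J * I = - (I * J)].
Proof.
split; [by rewrite -expr2 hI | by rewrite -expr2 hJ |].
exact/imag_anticomm.
Qed.

(** 1, I, J, IJ multiply like the standard basis, so frame I J is an automorphism of
    the algebra carrying i to I and j to J. *)
Lemma frameM x y : frame I J (x * y) = frame I J x * frame I J y.
Proof.
have [II JJ JI] := frame_table.
have IK : I * (I * J) = - J by rewrite mulrA II mulN1r.
have JK : J * (I * J) = I by rewrite mulrA JI mulNr -mulrA JJ mulrN1 opprK.
have KI : (I * J) * I = J by rewrite -mulrA JI mulrN IK opprK.
have KJ : (I * J) * J = - I by rewrite -mulrA JJ mulrN1.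
have KK : (I * J) * (I * J) = -1 by rewrite -mulrA JK II.
rewrite /frame !(mulrDl, mulrDr) -!(scalerAl, scalerAr) !mul1r !mulr1.
rewrite II JJ JI IK JK KI KJ KK !qreM !qiM !qjM !qkM.
set K := I * J; apply: quatP; rewrite !(qcoordE, qreN, qiN, qjN, qkN);
  rewrite ?qre1 ?qi1 ?qj1 ?qk1; ring.
Qed.

Lemma frame_orthonormal :
  ((qdot 1 I = 0) * (qdot 1 J = 0) * (qdot 1 (I * J)%R = 0) *
   (qdot I 1 = 0) * (qdot J 1 = 0) * (qdot (I * J)%R 1 = 0) *
   (qdot I J = 0) * (qdot I (I * J)%R = 0) * (qdot J (I * J)%R = 0) *
   (qdot J I = 0) * (qdot (I * J)%R I = 0) * (qdot (I * J)%R J = 0) *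
   (qdot (1 : quat R) 1 = 1) * (qdot I I = 1) * (qdot J J = 1) *
   (qdot (I * J)%R (I * J)%R = 1))%type.
Proof.
have [I0 I1] := (imag_sphereP I).1 hI; have [J0 J1] := (imag_sphereP J).1 hJ.
have e1 : qdot 1 I = 0 by rewrite qdotE !qopE I0; ring.
have e2 : qdot 1 J = 0 by rewrite qdotE !qopE J0; ring.
have e3 : qdot 1 (I * J) = 0 by rewrite qdot_imagM// mulr1 hIJ oppr0.
have e4 : qdot I (I * J) = 0 by rewrite qdotE !qopE I0 J0; ring.
have e5 : qdot J (I * J) = 0 by rewrite qdotE !qopE I0 J0; ring.
have e6 : qdot (I * J) (I * J) = 1 by rewrite qdotM I1 J1 mulr1.
by do !split; rewrite // ?qdot11// qdotC.
Qed.

Lemma frameK x : frame_coord I J (frame I J x) = x.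
Proof.
rewrite /frame_coord /frame !qdotDl !qdotZl !frame_orthonormal.
by apply: quatP; rewrite !qcoordE; ring.
Qed.

Lemma qdot_frame x : qdot (frame I J x) (frame I J x) = qdot x x.
Proof.
rewrite {1 2}/frame !(qdotDl, qdotDr) !(qdotZl, qdotZr) !frame_orthonormal.
by rewrite qdotE; ring.
Qed.

Lemma frame_conj x : frame I J (qconj x) = qconj (frame I J x).
Proof.
have [_ _ JI] := frame_table.
have cK : qconj (I * J) = - (I * J) by rewrite qconjM !qconj_imag// mulrNN JI.
rewrite /frame !qconjD !qconjZ qconj1 cK (qconj_imag hI) (qconj_imag hJ).
generalize (I * J) => K; clear.
by apply: quatP; rewrite /qconj !qopE; ring.
Qed.

End orthogonal_pair.

End frames.

(** cos (3x) = -1 for x = pi / 3 reads (c + 1) (2c - 1)^2 = 0. *)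
Lemma cos_pi3 {R : realType} : cos (pi / 3) = 2^-1 :> R.
Proof.
set c := cos _; have c0 : 0 < c.
  apply: cos_gt0_pihalf; have := pi_gt0 R => p0; apply/andP; split; lra.
have : cos (pi / 3 + pi / 3 + pi / 3) = -1 :> R.
  by rewrite -[RHS](cospi R); congr cos; field.
rewrite !cosD !sinD -/c; set s := sin _ => e.
have s2 : s ^+ 2 = 1 - c ^+ 2 by have := cos2Dsin2 (pi / 3 : R); rewrite -/c -/s; lra.
have : (c + 1) * (2 * c - 1) ^+ 2 = 0.
  transitivity (c * c * c - 3 * c * s ^+ 2 + 1); first by rewrite s2; ring.
  by apply/eqP; rewrite addr_eq0 -e; apply/eqP; ring.
move=> /eqP; rewrite mulf_eq0 gt_eqF ?addr_gt0//= sqrf_eq0 subr_eq0 => /eqP c2.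
by apply: (mulfI (x := 2)); rewrite ?pnatr_eq0// c2 mulfV// pnatr_eq0.
Qed.

Lemma sqr_sin_pi3 {R : realType} : sin (pi / 3) ^+ 2 = 3 / 4 :> R.
Proof. by have := cos2Dsin2 (pi / 3 : R); rewrite cos_pi3; lra. Qed.

(** * The hexagonal order and its units *)

Section hexagonal_form.

Lemma hexform_ge0 (k l : int) : (0 <= k * k + k * l + l * l)%R.
Proof. nia. Qed.

Lemma hexform_eq0 (k l : int) : k * k + k * l + l * l = 0 -> k = 0 /\ l = 0.
Proof. by move=> e; split; nia. Qed.

Lemma hexform_eq1 (k l : int) : k * k + k * l + l * l = 1 ->
  (k, l) \in [:: (1, 0); (-1, 0); (0, 1); (0, -1); (1, -1); (-1, 1)].
Proof.
move=> e.
have k1 : (-1 <= k <= 1)%R by apply/andP; split; nia.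
have l1 : (-1 <= l <= 1)%R by apply/andP; split; nia.
have k3 : k = -1 \/ k = 0 \/ k = 1 by lia.
have l3 : l = -1 \/ l = 0 \/ l = 1 by lia.
move/eqP: e; apply/implyP; move: k3 l3.
by move=> [->|[->|->]] [->|[->|->]].
Qed.

Lemma real_hexform_ge0 {R : realType} (s t : R) : 0 <= s * s + s * t + t * t.
Proof. nra. Qed.

Lemma real_hexform_eq0 {R : realType} (s t : R) : s * s + s * t + t * t = 0 ->
  s = 0 /\ t = 0.
Proof.
move=> e; have t0 : t = 0.
  apply/eqP; rewrite -sqrf_eq0 eq_le sqr_ge0 andbT.
  by have := sqr_ge0 (2 * s + t); have := sqr_ge0 t; rewrite !expr2; nra.
split => //; move/eqP: e; rewrite t0 mulr0 mulr0 !addr0 mulf_eq0 orbb.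
by move=> /eqP.
Qed.

(** Rounding t first and then s + (t - l) / 2 completes the square: the two squares
    are at most 1/4 and 3/16. *)
Lemma hexagonal_rounding {R : realType} (s t : R) : exists k l : int,
  (s - k%:~R) * (s - k%:~R) + (s - k%:~R) * (t - l%:~R) +
  (t - l%:~R) * (t - l%:~R) <= 7 / 16.
Proof.
have round (x : R) : exists k : int, - (1 / 2) <= x - k%:~R <= 1 / 2.
  exists (Num.floor (x + 1 / 2)).
  have := floor_le (x + 1 / 2); have := floorD1_gt (x + 1 / 2).
  by rewrite intrD => h1 h2; apply/andP; split; lra.
have [l /andP[l1 l2]] := round t.
have [k /andP[k1 k2]] := round (s + (t - l%:~R) / 2).
(* Here |y| <= 1/2 and |x + y/2| <= 1/2, and x^2 + xy + y^2 = (x + y/2)^2 + 3/4 y^2. *)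
exists k, l; set x := s - k%:~R; set y := t - l%:~R.
have : (x + y / 2) * (x + y / 2) <= 1 / 4.
  have /andP[? ?] : - (1 / 2) <= x + y / 2 <= 1 / 2; last by nra.
  by apply/andP; rewrite /x /y; split; lra.
have : y * y <= 1 / 4 by rewrite /y; nra.
by nra.
Qed.

End hexagonal_form.

Lemma sum_ord4 (V : nmodType) (F : 'I_4 -> V) : \sum_i F i = F 0 + F 1 + F 2 + F 3.
Proof.
rewrite !big_ord_recl big_ord0 addr0 !addrA.
by congr (F _ + F _ + F _ + F _); apply/val_inj.
Qed.

Section hexagonal_order.
Context {R : realType}.
Implicit Types (I J q x y : quat R).

(** The coefficients are real, so that the same formulas serve for the elements of the
    order and for the quaternions that are rounded to them. *)
Definition hexlin I J (s t u v : R) : quat R :=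
  s *: 1 + t *: qexp (pi / 3) I + u *: J + v *: (J * qexp (pi / 3) I).

(** For orthogonal I and J this is the maximal order Z [w] + J Z [w] of the rational
    quaternion algebra ramified at 3 and at infinity, where w = e^(pi I / 3). *)
Definition hexorder I J : set (quat R) :=
  [set q | exists k l m n : int, q = hexlin I J k%:~R l%:~R m%:~R n%:~R].

Lemma zspan_hexorder I J :
  zspan [tuple 1; qexp (pi / 3) I; J; J * qexp (pi / 3) I] = hexorder I J.
Proof.
apply/seteqP; split => q.
  by move=> [n ->]; exists (n 0), (n 1), (n 2), (n 3); rewrite /hexlin !scaler_int sum_ord4.
move=> [k [l [m [n ->]]]]; exists (fun i : 'I_4 => [:: k; l; m; n]`_i).
by rewrite sum_ord4 /hexlin !scaler_int.
Qed.

Lemma hexlinB I J s t u v s' t' u' v' :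
  hexlin I J s t u v - hexlin I J s' t' u' v' =
  hexlin I J (s - s') (t - t') (u - u') (v - v').
Proof.
rewrite /hexlin; generalize (J * qexp (pi / 3) I) (qexp (pi / 3) I) => X W.
by rewrite !scalerBl !opprD !addrA; apply: quatP; rewrite !qopE; ring.
Qed.

Section orthogonal_pair.
Variables (I J : quat R).
Hypotheses (hI : imag_sphere I) (hJ : imag_sphere J) (hIJ : qdot I J = 0).
Local Notation w := (qexp (pi / 3) I).
Local Notation sigma := (sin (pi / 3) : R).

Lemma hexlin_frame s t u v : hexlin I J s t u v =
  frame I J (Quat (s + t / 2) (sigma * t) (u + v / 2) (- (sigma * v))).
Proof.
have [II JJ JI] := frame_table hI hJ hIJ.
rewrite /hexlin /frame /qexp cos_pi3 mulrDr -!scalerAr mulr1 JI.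
by set K := I * J; apply: quatP; rewrite !qopE; field.
Qed.

Lemma qdot_hexlin s t u v : qdot (hexlin I J s t u v) (hexlin I J s t u v) =
  s * s + s * t + t * t + (u * u + u * v + v * v).
Proof.
rewrite hexlin_frame qdot_frame// qdotE !qcoordE.
have -> : (s + t / 2) * (s + t / 2) + sigma * t * (sigma * t) +
  (u + v / 2) * (u + v / 2) + - (sigma * v) * - (sigma * v) =
  (s + t / 2) * (s + t / 2) + sigma ^+ 2 * (t * t) +
  (u + v / 2) * (u + v / 2) + sigma ^+ 2 * (v * v) by ring.
by rewrite sqr_sin_pi3; field.
Qed.

Lemma qdot_hexlin2 s t u v s' t' u' v' :
  qdot (hexlin I J s t u v) (hexlin I J s' t' u' v') =
  s * s' + (s * t' + t * s') / 2 + t * t' + (u * u' + (u * v' + v * u') / 2 + v * v').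
Proof.
have polar x y : qdot x y = (qdot (x + y) (x + y) - qdot x x - qdot y y) / 2.
  by rewrite !qdotDl !qdotDr [qdot y x]qdotC; field.
have hexlinD : hexlin I J s t u v + hexlin I J s' t' u' v' =
    hexlin I J (s + s') (t + t') (u + u') (v + v').
  by rewrite /hexlin !scalerDl; generalize w => W; apply: quatP; rewrite !qopE; ring.
by rewrite polar hexlinD !qdot_hexlin; field.
Qed.

Lemma hexlin_eq0 s t u v : hexlin I J s t u v = 0 -> [/\ s = 0, t = 0, u = 0 & v = 0].
Proof.
move=> /(congr1 (fun q => qdot q q)); rewrite qdot_hexlin qdot0r => e.
have e1 := real_hexform_ge0 s t; have e2 := real_hexform_ge0 u v.
have [-> ->] : s = 0 /\ t = 0 by apply: real_hexform_eq0; lra.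
have [-> ->] : u = 0 /\ v = 0 by apply: real_hexform_eq0; lra.
by [].
Qed.

(** w is a root of the sixth cyclotomic polynomial x^2 - x + 1, and conjugation by J
    maps it to its inverse 1 - w. *)
Lemma hex_table : [/\ w * w = w - 1, w * J = J - J * w & w ^+ 3 = -1].
Proof.
have [II JJ JI] := frame_table hI hJ hIJ.
have ww : w * w = w - 1.
  rewrite /qexp cos_pi3 mulrDl !mulrDr -!scalerAl -!scalerAr !mul1r mulr1 II.
  have := sqr_sin_pi3 (R := R); set sg := sin _ => s2.
  rewrite (_ : _ *: (_ *: - 1) = (3 / 4) *: - 1 :> quat R); last by rewrite scalerA -expr2 s2.
  by apply: quatP; rewrite !qopE; field.
split => //; last first.
  by rewrite !exprS expr0 mulr1 ww mulrBr ww mulr1 addrAC subrr sub0r.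
rewrite /qexp cos_pi3 mulrDl mulrDr -!scalerAl -!scalerAr mul1r mulr1 JI.
by set K := I * J; apply: quatP; rewrite !qopE; field.
Qed.

Lemma hexlin_mulw s t u v :
  hexlin I J s t u v * w = hexlin I J (- t) (s + t) (- v) (u + v).
Proof.
have [ww _ _] := hex_table.
rewrite /hexlin; move: ww; generalize w => W ww.
rewrite !mulrDl -!scalerAl mul1r ww -mulrA ww mulrBr mulr1.
by set X := J * W; apply: quatP; rewrite !qopE; ring.
Qed.

Lemma hexlin_mulJ s t u v :
  hexlin I J s t u v * J = hexlin I J (- u - v) v (s + t) (- t).
Proof.
have [ww wJ _] := hex_table; have [II JJ JI] := frame_table hI hJ hIJ.
rewrite /hexlin; move: wJ; generalize w => W wJ.
rewrite !mulrDl -!scalerAl mul1r -mulrA wJ JJ mulrBr mulrA JJ mulN1r.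
by set X := J * W; apply: quatP; rewrite !qopE; ring.
Qed.

Lemma qconj_hexlin s t u v :
  qconj (hexlin I J s t u v) = hexlin I J (s + t) (- t) (- u) (- v).
Proof.
rewrite !hexlin_frame -frame_conj//; congr (frame I J _).
by apply: quatP; rewrite /qconj !qopE; field.
Qed.

(** Only the two generators have to be tested, because the elements of the basis
    1, w, J, J w are products of them. *)
Lemma hexorder_module (L : lattice R) :
  (forall x, lattice_set L x -> lattice_set L (x * w)) ->
  (forall x, lattice_set L x -> lattice_set L (x * J)) ->
  forall x y, lattice_set L x -> hexorder I J y -> lattice_set L (x * y).
Proof.
move=> Lw LJ x _ Lx [k [l [m [n ->]]]].
rewrite /hexlin; move: Lw; generalize w => W Lw.
rewrite !mulrDr -!scalerAr mulr1 mulrA !scaler_int.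
have LxJ := LJ _ Lx.
apply: latticeD; [apply: latticeD; [apply: latticeD|]|]; apply: latticeMz => //;
  exact: Lw.
Qed.

Lemma hexbasis_free : free [tuple 1; w; J; J * w].
Proof.
apply/freeP => k; rewrite sum_ord4 => e.
have [k0 k1 k2 k3] := hexlin_eq0 e.
by case => -[|[|[|[|//]]]] i; [move: k0|move: k1|move: k2|move: k3] => <-;
  congr (k _); apply/val_inj.
Qed.

Definition hexlattice : lattice R :=
  Lattice (ex_intro2 _ _ [tuple 1; w; J; J * w] hexbasis_free
    (esym (zspan_hexorder I J))).

Lemma hexorder1 : hexorder I J 1.
Proof.
exists 1, 0, 0, 0; rewrite /hexlin !scale0r !addr0.
by rewrite -[1%:~R]/(1 : R) scale1r.
Qed.

(** An instance of the previous principle: the order is a right module over itself. *)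
Lemma hexorderM x y : hexorder I J x -> hexorder I J y -> hexorder I J (x * y).
Proof.
apply: (@hexorder_module hexlattice) => {}x [k [l [m [n ->]]]] /=.
  by rewrite hexlin_mulw; exists (- l), (k + l), (- n), (m + n); rewrite !intrD !intrN.
rewrite hexlin_mulJ; exists (- m - n), n, (k + l), (- l).
by rewrite !intrD !intrN.
Qed.

Lemma hexorder_conj x : hexorder I J x -> hexorder I J (qconj x).
Proof.
move=> [k [l [m [n ->]]]]; rewrite qconj_hexlin.
by exists (k + l), (- l), (- m), (- n); rewrite intrD !intrN.
Qed.

(** The order is an orthogonal sum of two hexagonal lattices, so its covering radius
    is less than 1: it is a Euclidean ring. *)
Lemma hexorder_rounding q : exists2 x, hexorder I J x & qdot (q - x) (q - x) <= 7 / 8.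
Proof.
pose v := [tuple 1; w; J; J * w].
have vfree : free v by exact: hexbasis_free.
have vbasis : basis_of fullv v.
  by rewrite basisEfree vfree subvf size_tuple dimvf.
have qE : q = hexlin I J (coord v 0 q) (coord v 1 q) (coord v 2 q) (coord v 3 q).
  by rewrite {1}(coord_basis vbasis (memvf q)) sum_ord4.
set s := coord v 0 q in qE; set t := coord v 1 q in qE.
set x := coord v 2 q in qE; set y := coord v 3 q in qE.
have [k [l kl]] := hexagonal_rounding s t.
have [m [n mn]] := hexagonal_rounding x y.
exists (hexlin I J k%:~R l%:~R m%:~R n%:~R); first by exists k, l, m, n.
have -> : q - hexlin I J k%:~R l%:~R m%:~R n%:~R =
    hexlin I J (s - k%:~R) (t - l%:~R) (x - m%:~R) (y - n%:~R).
  by rewrite {1}qE hexlinB.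
by rewrite qdot_hexlin; lra.
Qed.

(** The elements of norm 1 of the order form a group, closed under inverses as these
    are conjugates. Conversely a sum of two integral hexagonal forms is 1 only if one
    of them is 1 and the other 0, which leaves w^k and J w^k. *)
Lemma dic6E : dic6 I J = [set q | hexorder I J q /\ qdot q q = 1].
Proof.
have [ww wJ w3] := hex_table; have [II JJ JI] := frame_table hI hJ hIJ.
have wE : w = hexlin I J 0 1 0 0.
  by rewrite /hexlin !scale0r scale1r !addr0 add0r.
have JE : J = hexlin I J 0 0 1 0.
  by rewrite /hexlin !scale0r scale1r addr0 !add0r.
apply/seteqP; split.
  apply: smallest_sub.
    split.
    - by move=> q [_ q1]; apply/unit_sphereP.
    - by split; [exact: hexorder1 | exact: qdot11].
    - move=> x y [Ox x1] [Oy y1]; split; first exact: hexorderM.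
      by rewrite qdotM x1 y1 mulr1.
    - by move=> x [Ox x1]; rewrite qinv_unit//; split; [exact: hexorder_conj | rewrite qdot_conj].
  move=> q [->|->]; split.
  - by exists 0, 1, 0, 0; rewrite -wE.
  - by rewrite wE qdot_hexlin; ring.
  - by exists 0, 0, 1, 0; rewrite -JE.
  - by have [] := (imag_sphereP J).1 hJ.
move=> q [[k [l [m [n qE]]]] q1] G [[_ G1 GM GV] Ggen].
have Gw : G w by apply: Ggen; left.
have GJ : G J by apply: Ggen; right.
have GN x : G x -> G (- x).
  by move=> Gx; rewrite -mulN1r -JJ; exact: (GM _ _ (GM _ _ GJ GJ) Gx).
have Gw2 : G (w - 1) by rewrite -ww; exact: GM.
have Gw2' : G (1 - w) by rewrite -opprB; exact: GN.
(* The six integral points of norm 1 in the hexagonal lattice. *)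
have form k' l' : (k', l') \in [:: (1, 0); (-1, 0); (0, 1); (0, -1); (1, -1); (-1, 1)] ->
    G (k'%:~R *: 1 + l'%:~R *: w).
  rewrite !inE => /or4P[|||/or3P[||]] /eqP[-> ->];
    rewrite ?scale0r ?scaleN1r ?scale1r ?add0r ?addr0 ?mulrN1z ?scaleN1r ?scale1r //; try exact: GN.
  by rewrite addrC.
have : k * k + k * l + l * l + (m * m + m * n + n * n) = 1.
  apply: (@intr_inj R); rewrite -[RHS]q1 qE qdot_hexlin !intrD !intrM; ring.
have := hexform_ge0 k l; have := hexform_ge0 m n.
move=> h1 h2 e.
have [[e1 e2]|[e1 e2]] : (k * k + k * l + l * l = 1 /\ m * m + m * n + n * n = 0) \/
    (k * k + k * l + l * l = 0 /\ m * m + m * n + n * n = 1) by lia.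
  have [m0 n0] := hexform_eq0 e2.
  rewrite qE m0 n0 /hexlin !scale0r !addr0; exact/form/hexform_eq1.
have [k0 l0] := hexform_eq0 e1.
rewrite qE k0 l0 /hexlin !scale0r !add0r.
have -> : m%:~R *: J + n%:~R *: (J * w) = J * (m%:~R *: 1 + n%:~R *: w).
  by generalize w => W; rewrite mulrDr -!scalerAr mulr1.
exact: (GM _ _ GJ (form _ _ (hexform_eq1 e2))).
Qed.

End orthogonal_pair.
End hexagonal_order.

(** * Modulus and automorphisms *)

Section modulus.
Context {R : realType}.
Implicit Types (L : lattice R) (I J a b c x y q : quat R).

Lemma qmulVK x y : x != 0 -> x^-1 * (x * y) = y.
Proof. by move=> x0; rewrite mulrA [x^-1 * x](qmulVq x0) mul1r. Qed.

Lemma qmulKV x y : x != 0 -> x * (x^-1 * y) = y.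
Proof. by move=> x0; rewrite mulrA [x * x^-1](qmulqV x0) mul1r. Qed.

Lemma qmulrK x y : x != 0 -> y * x * x^-1 = y.
Proof. by move=> x0; rewrite -mulrA [x * x^-1](qmulqV x0) mulr1. Qed.

Lemma qmulrVK x y : x != 0 -> y * x^-1 * x = y.
Proof. by move=> x0; rewrite -mulrA [x^-1 * x](qmulVq x0) mulr1. Qed.

Lemma lattice_nontrivial L : exists2 x, lattice_set L x & x != 0.
Proof.
have [v vfree LE] := lattice_basis L; exists (tnth v 0); last first.
  by apply: (free_not0 vfree); exact: mem_tnth.
rewrite LE; exists (fun i => (i == 0)%:R); rewrite (bigD1 0)//= big1 ?addr0//.
by move=> i /negbTE ->; rewrite mulr0z.
Qed.

(** Euclidean division. Let x be a nearly shortest nonzero element of L. For y in L,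
    subtracting from y the multiple of x by a rounding of x^-1 y leaves an element of L
    shorter than all the nonzero ones. Near-minimality suffices because the rounding
    factor is bounded away from 1. *)
Lemma lattice_principal L I J :
  imag_sphere I -> imag_sphere J -> qdot I J = 0 ->
  (forall x, lattice_set L x -> lattice_set L (x * qexp (pi / 3) I)) ->
  (forall x, lattice_set L x -> lattice_set L (x * J)) ->
  exists2 x, x != 0 & forall y, lattice_set L y <-> hexorder I J (x^-1 * y).
Proof.
move=> hI hJ hIJ Lw LJ.
pose S : set R := [set qdot x x | x in [set x | lattice_set L x /\ x != 0]].
have [e e0 eP] := lattice_discrete L.
have Slb : lbound S (e ^+ 2).
  move=> _ [x [Lx x0] <-]; apply: le_trans (sqr_norm_le_qdot x).
  have ex : e <= `|x|.
    by rewrite leNgt; apply/negP => /(eP _ Lx) xe; rewrite xe eqxx in x0.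
  by rewrite lerXn2r// nnegrE ?(ltW e0).
have Sinf : has_inf S.
  split; last by exists (e ^+ 2).
  by have [x Lx x0] := lattice_nontrivial L; exists (qdot x x); exists x.
have m0 : 0 < inf S.
  apply: lt_le_trans (lb_le_inf Sinf.1 Slb); exact: exprn_gt0.
(* 1/7 is what the factor 7/8 of the rounding bound allows: 7/8 (1 + 1/7) = 1. *)
have [_ [x [Lx x0] <-] xm] := inf_adherent (divr_gt0 m0 (ltr0n _ 7)) Sinf.
have LxO o : hexorder I J o -> lattice_set L (x * o) by exact: hexorder_module.
exists x => // y; split; last by move=> /LxO; rewrite qmulKV.
move=> Ly; have [z Oz zy] := hexorder_rounding hI hJ hIJ (x^-1 * y).
have [/subr0_eq -> //|d0] := eqVneq (y - x * z) 0; first by rewrite qmulVK.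
exfalso.
have : inf S <= qdot (y - x * z) (y - x * z).
  apply: ge_inf; first exact: Sinf.2.
  by exists (y - x * z) => //; split => //; apply: latticeB => //; exact: LxO.
have -> : y - x * z = x * (x^-1 * y - z) by rewrite mulrBr qmulKV.
rewrite qdotM; apply/negP; rewrite -ltNge.
apply: le_lt_trans (ler_wpM2l (qdot_ge0 x) zy) _.
lra.
Qed.

Lemma qexp_conj x y alpha I : x * y = 1 ->
  qexp alpha (x * I * y) = x * qexp alpha I * y.
Proof. by move=> xy; rewrite /qexp mulrDr mulrDl -!scalerAr -!scalerAl mulr1 xy. Qed.

Lemma hexlin_conj x y I J s t u v : x * y = 1 -> y * x = 1 ->
  hexlin (x * I * y) (x * J * y) s t u v = x * hexlin I J s t u v * y.
Proof.
move=> xy yx; rewrite /hexlin qexp_conj//; generalize (qexp (pi / 3) I) => W.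
rewrite !mulrDr !mulrDl -!scalerAr -!scalerAl mulr1 xy !mulrA.
by rewrite -[x * J * y * x]mulrA yx mulr1.
Qed.

Lemma imag_sphere_conj x I : x != 0 -> imag_sphere I -> imag_sphere (x * I * x^-1).
Proof.
move=> x0 hI; rewrite /imag_sphere /= expr2 !mulrA qmulrVK// -[x * I * I]mulrA -expr2 hI.
by rewrite mulrN1 mulNr [x * x^-1]qmulqV.
Qed.

Lemma qdot_conj_pair x I J : x != 0 -> imag_sphere I -> imag_sphere J ->
  qdot I J = 0 -> qdot (x * I * x^-1) (x * J * x^-1) = 0.
Proof.
move=> x0 hI hJ hIJ.
apply/(imag_anticomm (imag_sphere_conj x0 hI) (imag_sphere_conj x0 hJ)).
rewrite !mulrA !qmulrVK// -[x * J * I]mulrA (imag_anticomm hI hJ).1//.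
by rewrite mulrN mulNr mulrA.
Qed.

(** The squared lengths of the lattice vectors are the values of an integral positive
    definite form, hence at least 1 for nonzero ones, and the basis vectors have
    length 1. *)
Lemma hex_moduli I J : imag_sphere I -> imag_sphere J -> qdot I J = 0 ->
  moduli_set (qexp (pi / 3) I, J, J * qexp (pi / 3) I).
Proof.
move=> hI hJ hIJ; rewrite /moduli_set /=.
set v := [tuple _; _; _; _].
have vE k : tnth v k = hexlin I J (k == 0)%:R (k == 1)%:R (k == 2)%:R (k == 3)%:R.
  rewrite /hexlin; case: k => -[|[|[|[|//]]]] ?;
  by rewrite (tnth_nth 0) /= !scale0r scale1r ?addr0 ?add0r.
split; [exact: hexbasis_free | | by []].
split.
  move=> k l lk; rewrite mxE !vE (qdot_hexlin2 hI hJ hIJ).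
  by case: k lk => -[|[|[|[|//]]]] ? /= lk; case: l lk => -[|[|[|[|//]]]] ? //= _;
    rewrite !(mul0r, mulr0, mul1r, mulr1, add0r, addr0, oner_eq0) //; lra.
move=> k n n1; set nR := map_mx intr n; rewrite /= mxE vE qdot_hexlin//.
have -> : (nR *m gram v *m nR^T) 0 0 =
    qdot (hexlin I J (n 0 0)%:~R (n 0 1)%:~R (n 0 2)%:~R (n 0 3)%:~R)
         (hexlin I J (n 0 0)%:~R (n 0 1)%:~R (n 0 2)%:~R (n 0 3)%:~R).
  have -> : hexlin I J (n 0 0)%:~R (n 0 1)%:~R (n 0 2)%:~R (n 0 3)%:~R =
    (n 0 0)%:~R *: tnth v 0 + (n 0 1)%:~R *: tnth v 1 + (n 0 2)%:~R *: tnth v 2 +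
    (n 0 3)%:~R *: tnth v 3 by [].
  rewrite !qdotDl !qdotDr !qdotZl !qdotZr.
  by rewrite mxE sum_ord4 !mxE !sum_ord4 !mxE; ring.
rewrite qdot_hexlin//.
have -> : (k == 0)%:R * (k == 0)%:R + (k == 0)%:R * (k == 1)%:R + (k == 1)%:R * (k == 1)%:R +
  ((k == 2)%:R * (k == 2)%:R + (k == 2)%:R * (k == 3)%:R + (k == 3)%:R * (k == 3)%:R) = 1 :> R.
  by case: k {n1} => -[|[|[|[|//]]]] ? /=; rewrite !(mul0r, mulr0, mul1r, addr0, add0r).
set a := n 0 0; set b := n 0 1; set c := n 0 2; set d := n 0 3.
rewrite -!intrM -!intrD -[1]/(1%:~R) ler_int.
have := hexform_ge0 a b; have := hexform_ge0 c d => h1 h2.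
rewrite -gtz0_ge1 lt_def addr_ge0// andbT; apply/eqP => e.
have [a0 b0] : a = 0 /\ b = 0 by apply: hexform_eq0; lia.
have [c0 d0] : c = 0 /\ d = 0 by apply: hexform_eq0; lia.
have n0 i : n 0 i = 0.
  by case: i => -[|[|[|[|//]]]] ?; [rewrite -a0|rewrite -b0|rewrite -c0|rewrite -d0];
    congr (n _ _); apply/val_inj.
have : \big[gcdz/0]_(i < 4 | (k <= i)%N) n 0 i = 0.
  by elim/big_ind: _ => // x y -> ->.
by rewrite n1.
Qed.

Lemma torus_autP L (F : quat R -> quat R) : torus_aut L F ->
  exists a, [/\ qdot a a = 1, F = (fun q => q * a),
    (forall x, lattice_set L x -> lattice_set L (x * a)) &
    (forall x, lattice_set L (x * a) -> lattice_set L x)].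
Proof.
move=> [a /unit_sphereP a1 [FE LE]]; exists a; split => // x.
  by move=> Lx; rewrite -LE; exists x => //; rewrite FE.
have a0 : a != 0 by rewrite -qdot_eq0 a1 oner_eq0.
rewrite -{1}LE => -[y Ly]; rewrite FE => /(congr1 (fun q => q * a^-1)).
by rewrite !qmulrK// => <-.
Qed.

Lemma torus_aut_right_mul L a : qdot a a = 1 ->
  (forall x, lattice_set L x -> lattice_set L (x * a)) ->
  (forall x, lattice_set L x -> lattice_set L (x * a^-1)) ->
  torus_aut L (fun q => q * a).
Proof.
move=> a1 La LaV; exists a; first exact/unit_sphereP.
have a0 : a != 0 by rewrite -qdot_eq0 a1 oner_eq0.
split=> //; apply/seteqP; split => [_ [x Lx <-]|x Lx]; first exact: La.
by exists (x * a^-1); [exact: LaV | rewrite qmulrVK].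
Qed.

Lemma torus_aut_comp L F G : torus_aut L F -> torus_aut L G -> torus_aut L (F \o G).
Proof.
move=> [a /unit_sphereP a1 [-> La]] [b /unit_sphereP b1 [-> Lb]].
exists (b * a); first by apply/unit_sphereP; rewrite qdotM a1 b1 mulr1.
split; first by apply/funext => q /=; rewrite mulrA.
by rewrite -image_comp Lb La.
Qed.

(** The relations force b^4 = 1, and b^2 = 1 is excluded by a^4 <> a; so
    a^3 = b^2 = -1, and a <> -1 leaves a^2 - a + 1 = 0. The imaginary part of a then
    gives I, and a b a = b says that I and b anticommute. *)
Lemma hex_relations a b : qdot a a = 1 -> a * (a * a) = b * b -> a * (b * a) = b ->
  a * (a * (a * a)) != a -> a != b * b ->
  exists I, [/\ imag_sphere I, imag_sphere b, qdot I b = 0 & qexp (pi / 3) I = a].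
Proof.
move=> a1 aaa aba a4 abb.
have a0 : a != 0 by rewrite -qdot_eq0 a1 oner_eq0.
have b0 : b != 0.
  apply/eqP => b0; move: aaa; rewrite b0 mulr0 => /eqP.
  by rewrite !qmul_eq0 (negbTE a0).
(* Iterating a b a = b gives a^3 b a^3 = b, that is b^4 = 1. *)
have c2 : (b * b) * (b * b) = 1.
  have e : (a * (a * a)) * b * (a * (a * a)) = b.
    have zaba z : z * a * b * a = z * b by rewrite -!mulrA aba.
    by rewrite !mulrA !zaba -mulrA.
  rewrite aaa in e; have := congr1 (fun q => b^-1 * q) e; rewrite -!mulrA qmulVK//.
  by rewrite [b^-1 * b]qmulVq// !mulrA.
have bb : b * b = -1.
  have : (b * b - 1) * (b * b + 1) = 0.
    move: c2; generalize (b * b) => z zz.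
    by rewrite mulrBl mulrDr zz mulr1 mul1r [1 + z]addrC subrr.
  move=> /eqP; rewrite qmul_eq0 subr_eq0 addr_eq0 => /orP[/eqP e|/eqP //].
  by move: a4; rewrite aaa e mulr1 eqxx.
have aa : a * a = a - 1.
  have : (a + 1) * (a * a - a + 1) = 0.
    rewrite mulrDl mul1r mulrDr mulrBr mulr1 aaa bb.
    by set x := a * a; apply: quatP; rewrite !qopE; ring.
  have am1 : (a == -1) = false by rewrite -bb; exact: negbTE.
  move=> /eqP; rewrite qmul_eq0 addr_eq0 am1 /= => /eqP e.
  by apply/subr0_eq; rewrite opprB addrA addrAC.
pose sg : R := sin (pi / 3); have sg2 : sg ^+ 2 = 3 / 4 := sqr_sin_pi3.
have sg0 : sg != 0 by rewrite -sqrf_eq0 sg2 mulf_neq0 ?invr_eq0 ?pnatr_eq0.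
pose I := sg^-1 *: (a - 2^-1 *: 1).
have IE : qexp (pi / 3) I = a.
  by rewrite /qexp -/sg /I scalerA divff// scale1r cos_pi3 addrC subrK.
have hI : imag_sphere I.
  rewrite /imag_sphere /= expr2 /I -scalerAl -scalerAr scalerA -invfM -expr2 sg2.
  rewrite mulrBl !mulrBr aa -!scalerAl -!scalerAr !mul1r !mulr1.
  by apply: quatP; rewrite !qopE; field.
have hb : imag_sphere b by rewrite /imag_sphere /= expr2.
exists I; split => //; apply/imag_anticomm => //.
have ba : b * a = b - a * b.
  have := congr1 (fun q => a * q) aba; rewrite mulrA aa mulrBl mul1r aba => <-.
  by rewrite opprB addrC subrK.
have -> : b * I = sg^-1 *: (b * (a - 2^-1 *: 1)) by rewrite /I scalerAr.
have -> : I * b = sg^-1 *: ((a - 2^-1 *: 1) * b) by rewrite /I scalerAl.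
rewrite -[RHS]scalerN; congr (_ *: _).
rewrite mulrBl mulrBr ba -!scalerAl -!scalerAr mul1r mulr1.
by set x := a * b; apply: quatP; rewrite !qopE; field.
Qed.

End modulus.

Section two_directions.
Context {R : realType}.
Implicit Types (L : lattice R) (I J a b c x y q : quat R).

Lemma dic6_gens I J : dic6 I J (qexp (pi / 3) I) /\ dic6 I J J.
Proof. by split => G [_ Ggen]; apply: Ggen; [left | right]. Qed.

(** The automorphisms attached to the generators of the group make L a right module
    over a hexagonal order, so that L is the multiple of the order by some x. Then
    right multiplication by x^-1 carries L to x O x^-1, which is again a hexagonal order. *)
Lemma dic6_automorphisms_modulus L I0 J0 :
  imag_sphere I0 -> imag_sphere J0 -> qdot I0 J0 = 0 ->
  group_isomorphic (torus_aut L) (fun F G => F \o G) (dic6 I0 J0) (fun x y => x * y) ->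
  exists I J : quat R,
    [/\ imag_sphere I, imag_sphere J, qdot J I = 0 &
        is_modulus L (qexp (pi / 3) I, J, J * qexp (pi / 3) I)].
Proof.
move=> hI0 hJ0 hIJ0 [phi [_ phi_inj phi_surj] phiM].
have [dw dJ] := dic6_gens I0 J0.
have [ww wJ w3] := hex_table hI0 hJ0 hIJ0.
have [_ JJ _] := frame_table hI0 hJ0 hIJ0.
set w := qexp (pi / 3) I0 in dw ww wJ w3.
have w_neq : w != -1.
  apply/eqP => e; move: (congr1 (@qre R) e).
  have [I00 _] := (imag_sphereP I0).1 hI0.
  rewrite /w /qexp cos_pi3 !qopE I00; lra.
have w1 : qdot w w = 1 by move: dw; rewrite dic6E// => -[].
clearbody w.
(* FA and FB correspond to the generators; they are right multiplications by a and
   b, and the relations between the generators pass to a and b. *)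
have [FA autA phiA] := phi_surj _ dw; have [FB autB phiB] := phi_surj _ dJ.
have [a [a1 FAE La _]] := torus_autP autA.
have [b [b1 FBE Lb _]] := torus_autP autB.
have phiMul F G : torus_aut L F -> torus_aut L G -> phi (F \o G) = phi F * phi G.
  by move=> aF aG; apply: phiM; rewrite inE.
have inj F G : torus_aut L F -> torus_aut L G -> phi F = phi G -> F 1 = G 1.
  by move=> aF aG e; suff -> : F = G by []; apply: phi_inj; rewrite ?inE.
have AA : torus_aut L (FA \o FA) by exact: torus_aut_comp.
have AAA : torus_aut L (FA \o (FA \o FA)) by exact: torus_aut_comp.
have AAAA : torus_aut L (FA \o (FA \o (FA \o FA))) by exact: torus_aut_comp.
have BB : torus_aut L (FB \o FB) by exact: torus_aut_comp.
have BA : torus_aut L (FB \o FA) by exact: torus_aut_comp.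
have ABA : torus_aut L (FA \o (FB \o FA)) by exact: torus_aut_comp.
have phiAA : phi (FA \o FA) = w * w by rewrite (phiMul _ _ autA autA) phiA.
have phiAAA : phi (FA \o (FA \o FA)) = -1.
  by rewrite (phiMul _ _ autA AA) phiAA phiA -w3 !exprS expr0 mulr1.
have phiBB : phi (FB \o FB) = -1 by rewrite (phiMul _ _ autB autB) phiB.
have hab : a * (a * a) = b * b.
  have := inj _ _ AAA BB; rewrite phiAAA phiBB => /(_ erefl).
  by rewrite FAE FBE /= !mul1r mulrA.
have aba : a * (b * a) = b.
  have : phi (FA \o (FB \o FA)) = phi FB.
    rewrite (phiMul _ _ autA BA) (phiMul _ _ autB autA) phiA phiB.
    by rewrite mulrA wJ mulrBl -mulrA ww mulrBr mulr1 subKr.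
  by move=> /(inj _ _ ABA autB); rewrite FAE FBE /= !mul1r mulrA.
have a4 : a * (a * (a * a)) != a.
  apply/eqP => e.
  have FE : FA \o (FA \o (FA \o FA)) = FA.
    by apply/funext => q; rewrite FAE /= -!mulrA e.
  have : phi (FA \o (FA \o (FA \o FA))) = - w.
    by rewrite (phiMul _ _ autA AAA) phiAAA phiA mulrN1.
  rewrite FE phiA => /(congr1 (fun q => qdot w q)).
  rewrite qdotNr w1; lra.
have abb : a != b * b.
  apply/eqP => e; have FE : FA = FB \o FB.
    by apply/funext => q; rewrite FAE FBE /= e mulrA.
  by move: w_neq; rewrite -phiA FE phiBB eqxx.
have [I [hI hb hIb IE]] := hex_relations a1 hab aba a4 abb.
have [x x0 LE] : exists2 x, x != 0 & forall y, lattice_set L y <-> hexorder I b (x^-1 * y).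
  by apply: lattice_principal => //; rewrite IE.
have xV : x * x^-1 = 1 by exact: qmulqV.
have Vx : x^-1 * x = 1 by exact: qmulVq.
exists (x * I * x^-1), (x * b * x^-1).
have hI' := imag_sphere_conj x0 hI; have hb' := imag_sphere_conj x0 hb.
have hIb' := qdot_conj_pair x0 hI hb hIb.
split => //; first by rewrite qdotC.
split; first exact: hex_moduli.
exists (hexlattice hI' hb' hIb'); split; first by rewrite /= zspan_hexorder.
apply: (right_scaling_equivalent (c := x^-1)).
  by apply/eqP => e; move: xV; rewrite e mulr0 => /esym/eqP; rewrite oner_eq0.
move=> y; rewrite LE /=; split=> -[k [l [m [n e]]]]; exists k, l, m, n.
  by rewrite hexlin_conj// -e qmulKV.
move: e; rewrite hexlin_conj// => /(congr1 (fun q => x^-1 * (q * x))).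
by rewrite !qmulrVK// qmulVK.
Qed.

(** If L c is the hexagonal order O, then conjugation by c identifies the automorphisms
    of L with the elements of norm 1 of O. *)
Lemma modulus_dic6_automorphisms L I J I0 J0 :
  imag_sphere I0 -> imag_sphere J0 -> qdot I0 J0 = 0 ->
  imag_sphere I -> imag_sphere J -> qdot I J = 0 ->
  is_modulus L (qexp (pi / 3) I, J, J * qexp (pi / 3) I) ->
  group_isomorphic (torus_aut L) (fun F G => F \o G) (dic6 I0 J0) (fun x y => x * y).
Proof.
move=> hI0 hJ0 hIJ0 hI hJ hIJ [_ [L' [/= L'E LL']]].
rewrite zspan_hexorder in L'E.
have [c c0 LE] := equivalent_right_scaling LL'; rewrite L'E in LE.
have cV : c * c^-1 = 1 by exact: qmulqV.
have Vc : c^-1 * c = 1 by exact: qmulVq.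
pose U : set (quat R) := [set z | hexorder I J (frame I J z) /\ qdot z z = 1].
have hexU z : hexorder I J (frame I J z) <-> hexorder I0 J0 (frame I0 J0 z).
  split=> -[k [l [m [n e]]]]; exists k, l, m, n; move: e; rewrite !hexlin_frame//.
    by move=> /(congr1 (frame_coord I J)); rewrite !frameK// => ->.
  by move=> /(congr1 (frame_coord I0 J0)); rewrite !frameK// => ->.
have autU F : torus_aut L F -> exists2 z, U z & c^-1 * F 1 * c = frame I J z.
  move=> /torus_autP[a [a1 -> La _]] /=; rewrite mul1r.
  have [k [l [m [n e]]]] : hexorder I J (c^-1 * a * c).
    apply/LE/La/LE; rewrite Vc; exact: hexorder1.
  move: (e); rewrite hexlin_frame//; set z := Quat _ _ _ _ => ez.
  exists z => //; split; first by rewrite -ez; exists k, l, m, n.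
  rewrite -(qdot_frame hI hJ hIJ) -ez !qdotM a1 mulr1 -qdotM Vc; exact: qdot11.
have Uaut z : U z -> torus_aut L (fun q => q * (c * frame I J z * c^-1)).
  move=> [Oz z1]; have fz1 : qdot (frame I J z) (frame I J z) = 1 by rewrite qdot_frame.
  set u := frame I J z in Oz fz1 *.
  have u0 : u != 0 by rewrite -qdot_eq0 fz1 oner_eq0.
  have uV : u * u^-1 = 1 by exact: qmulqV.
  have invE : (c * u * c^-1)^-1 = c * u^-1 * c^-1.
    have n1 : (c * u * c^-1) * (c * u^-1 * c^-1) = 1.
      by rewrite !mulrA qmulrVK// -[c * u * u^-1]mulrA uV mulr1 cV.
    have n0 : c * u * c^-1 != 0.
      by apply/eqP => e; move: n1; rewrite e mul0r => /esym/eqP; rewrite oner_eq0.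
    by rewrite -[RHS](qmulVK _ n0) n1 mulr1.
  have closed v : hexorder I J v -> forall x, lattice_set L x ->
      lattice_set L (x * (c * v * c^-1)).
    move=> Ov x /LE Lx; apply/LE; rewrite !mulrA qmulrVK//; exact: hexorderM.
  apply: torus_aut_right_mul.
  - by rewrite !qdotM fz1 mulr1 -qdotM cV; exact: qdot11.
  - exact: closed.
  - by rewrite invE; apply: closed; rewrite qinv_unit//; exact: hexorder_conj.
(* Composition reverses the order of the right factors, and conjugation reverses it
   back. *)
exists (fun F => frame I0 J0 (qconj (frame_coord I J (c^-1 * F 1 * c)))).
  split.
  - move=> F aF; have [z [Oz z1] ->] := autU F aF; rewrite frameK// dic6E//.
    split; last by rewrite qdot_frame// qdot_conj.
    by rewrite frame_conj//; apply/hexorder_conj => //; apply/hexU.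
  - move=> F G; rewrite !inE => aF aG.
    have [z [Oz z1] ez] := autU F aF; have [y [Oy y1] ey] := autU G aG.
    rewrite ez ey !frameK// => /(congr1 (frame_coord I0 J0)); rewrite !frameK//.
    move=> /(congr1 (@qconj R)); rewrite !qconjK => zy.
    have [a [_ FE _ _]] := torus_autP aF; have [b [_ GE _ _]] := torus_autP aG.
    move: ez ey; rewrite zy => <- /(congr1 (fun q => c * (q * c^-1))).
    by rewrite !qmulrK// !qmulKV// FE GE !mul1r => ->.
  - move=> q; rewrite dic6E// => -[[k [l [m [n qE]]]] q1].
    move: (qE); rewrite hexlin_frame//; set z := Quat _ _ _ _ => qz.
    have z1 : qdot z z = 1 by rewrite -(qdot_frame hI0 hJ0 hIJ0) -qz.
    have Uz : U (qconj z).
      split; last by rewrite qdot_conj.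
      rewrite frame_conj//; apply/hexorder_conj => //; apply/hexU.
      by rewrite -qz qE; exists k, l, m, n.
    exists (fun q => q * (c * frame I J (qconj z) * c^-1)); first exact: Uaut.
    by rewrite mul1r !mulrA Vc mul1r qmulrVK// frameK// qconjK.
move=> F G; rewrite !inE => aF aG.
have [z [Oz z1] ez] := autU F aF; have [y [Oy y1] ey] := autU G aG.
have [a [_ FE _ _]] := torus_autP aF; have [b [_ GE _ _]] := torus_autP aG.
have -> : c^-1 * (F \o G) 1 * c = frame I J (y * z).
  rewrite frameM// -ez -ey FE GE /= !mul1r !mulrA.
  by rewrite -[c^-1 * b * c * c^-1]mulrA cV mulr1.
by rewrite ez ey !frameK// qconjM frameM.
Qed.

End two_directions.

Theorem proposition8p18 (R : realType) (L : lattice R) (I0 J0 : quat R)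
    (hI0 : imag_sphere I0) (hJ0 : imag_sphere J0) (hIJ0 : qdot I0 J0 = 0) :
  group_isomorphic (torus_aut L) (fun F G => F \o G) (dic6 I0 J0) (fun x y => x * y)
  <->
  exists I J : quat R,
    [/\ imag_sphere I, imag_sphere J, qdot J I = 0 &
        is_modulus L (qexp (pi / 3) I, J, J * qexp (pi / 3) I)].
Proof.
split; first exact: dic6_automorphisms_modulus.
move=> [I [J [hI hJ hJI hmod]]].
by apply: (modulus_dic6_automorphisms hI0 hJ0 hIJ0 hI hJ _ hmod); rewrite qdotC.
Qed.
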